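(* Let $X_1,X_2,\dots$ be i.i.d. samples of a Gaussian variable $X$ with mean $\mu$ and unknown variance $\sigma^2$, and let $\theta=\mu/\sigma$. Suppose that $\alpha_i=O(\zeta)\in(0,1)$ and $\beta_i=O(\zeta)\in(0,1)$ for $i=1,\dots,m-1$. Let $2\le n_1<n_2<\dots<n_s$ be the sample sizes such that the largest sample size $n_s$ is no less than the minimum integer $n$ guaranteeing $(\theta_i''-\theta_i')\sqrt{n-1}\ge t_{n-1,\alpha_i}+t_{n-1,\beta_i}$ for $i=1,\dots,m-1$. For $i=1,\dots,m-1$ define $$f_{\ell,i}=\min\left\{\theta_i''-\frac{t_{n_\ell-1,\beta_i}}{\sqrt{n_\ell-1}},\ \frac{\theta_i'+\theta_i''}2+\frac{t_{n_\ell-1,\alpha_i}-t_{n_\ell-1,\beta_i}}{2\sqrt{n_\ell-1}}\right\},$$ $$g_{\ell,i}=\max\left\{\theta_i'+\frac{t_{n_\ell-1,\alpha_i}}{\sqrt{n_\ell-1}},\ \frac{\theta_i'+\theta_i''}2+\frac{t_{n_\ell-1,\alpha_i}-t_{n_\ell-1,\beta_i}}{2\sqrt{n_\ell-1}}\right\}.$$ For $\ell=1,\dots,s$ define $$\overline X_{n_\ell}=\frac{\sum_{i=1}^{n_\ell}X_i}{n_\ell},\qquad\tilde\sigma_{n_\ell}=\sqrt{\frac{\sum_{i=1}^{n_\ell}(X_i-\overline X_{n_\ell})^2}{n_\ell}},\qquad\hat\theta_\ell=\frac{\overline X_{n_\ell}}{\tilde\sigma_{n_\ell}},$$ $$D_\ell=\begin{cases}1&\text{for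 }\hat\theta_\ell\le f_{\ell,1},\\ i&\text{for }g_{\ell,i-1}<\hat\theta_\ell\le f_{\ell,i}\text{ where }2\le i\le m-1,\\ m&\text{for }\hat\theta_\ell>g_{\ell,m-1},\\0&\text{else.}\end{cases}$$ Then $\Pr\{\text{Reject }H_i\mid\theta\}$ is no greater than $\delta_i$ for any $\theta\in\varTheta_i$ and $i=0,1,\dots,m-1$ provided that $\zeta$ is sufficiently small.
   Context: Hypotheses on $\theta=\mu/\sigma$: $H_i:\theta\in\Theta_i$, $i=0,\dots,m-1$, where $\Theta_0=(-\infty,\theta_1]$, $\Theta_{m-1}=(\theta_{m-1},\infty)$, $\Theta_i=(\theta_i,\theta_{i+1}]$ for $1\le i\le m-2$, with $\theta_1<\dots<\theta_{m-1}$. $\varTheta_0=(-\infty,\theta_1']$, $\varTheta_{m-1}=[\theta_{m-1}'',\infty)$, $\varTheta_i=[\theta_i'',\theta_{i+1}']$ for $1\le i\le m-2$, where $\theta_i'<\theta_i<\theta_i''$ for $1\le i\le m-1$ and $\theta_i''\le\theta_{i+1}'$ for $1\le i\le m-2$. The numbers $\delta_i\in(0,1)$, $i=0,\dots,m-1$, are pre-specified. $t_{n,\alpha}$ denotes the $100(1-\alpha)\%$ percentile of the Student $t$-distribution with $n$ degrees of freedom (upper tail probability $\alpha$). Multistage plan: sampling continues until the first stage $\ell$ with $D_\ell\ne0$; $H_j$ is accepted if then $D_\ell=j+1$; ''Reject $H_i$'' means that some $H_j$ with $j\ne i$ is accepted. $\Pr\{\cdot\mid\theta\}$ is probability when the parameter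 is $\theta$. $\zeta>0$ is a risk tuning parameter; $\alpha_i,\beta_i$ are functions of $\zeta$, and $s$ and the sample sizes may depend on $\zeta$. $\delta=O(\zeta)$ means: $\delta$ is a function of $\zeta>0$ such that there exist constants $A$ and $B$ with $A<\delta/\zeta<B$ provided that $\zeta>0$ is sufficiently small.
   Formalization: In the definition of O(ζ), A < δ/ζ < B, the constant A is required to be positive, so all α_i and β_i are of exact order ζ; with A of arbitrary sign the claim fails, e.g. β_1 = ζ and α_1 = exp(-exp(exp(1/ζ))) with m = 2 and all sample sizes used. *)

(* Defs.v *)
From HB Require Import structures.
From mathcomp Require Import all_boot all_order all_algebra finmap.
From mathcomp Require Import all_classical all_reals all_analysis.
Set Implicit Arguments.
Unset Strict Implicit.
Unset Printing Implicit Defensive.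
Import Order.TTheory GRing.Theory Num.Theory.
Import numFieldNormedType.Exports.
Local Open Scope classical_set_scope.
Local Open Scope ring_scope.

Section student.
Context {R : realType}.

(* The density is normalised by its own total mass, whose closed form is
   sqrt (n pi) Gamma(n/2) / Gamma((n+1)/2). *)
Definition student_kernel (n : nat) (x : R) : R :=
  (1 + x ^+ 2 / n%:R) `^ (- (n.+1%:R / 2)).

Definition student_pdf (n : nat) (x : R) : R :=
  student_kernel n x / \int[lebesgue_measure]_y student_kernel n y.

Definition student_prob (n : nat) (A : set R) : \bar R :=
  (\int[lebesgue_measure]_(x in A) (student_pdf n x)%:E)%E.

(* The 100(1 - a)% percentile (a is the upper tail probability), in the sense
   of the generalised inverse of the cdf; meaningful for 0 < n and 0 < a < 1,
   where it is the unique t with P(T <= t) = 1 - a. *)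
Definition student_pct (n : nat) (a : R) : R :=
  inf [set t : R | ((1 - a)%:E <= student_prob n `]-oo, t])%E].

End student.

(* Both bounds are positive constants: for a positive function, a lower bound
   A <= 0 would say nothing. *)
Definition same_order_at0 (R : realType) (f : R -> R) : Prop :=
  exists A B : R, 0 < A /\ \forall z \near 0^'+, A < f z / z < B.

Section sampling.
Context {d : measure_display} {T : measurableType d} {R : realType}.

Definition mutually_independent (P : probability T R)
    (X : nat -> {RV P >-> R}) : Prop :=
  forall (J : {fset nat}) (B : nat -> set R),
    (forall i, measurable (B i)) ->
    P (\bigcap_(i in [set` J]) (X i @^-1` B i)) =
    (\prod_(i <- J) P (X i @^-1` B i))%E.

(* [sigma] is the standard deviation. *)
Definition iid_gaussian (P : probability T R) (X : nat -> {RV P >-> R})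
    (mu sigma : R) : Prop :=
  mutually_independent X /\
  forall (i : nat) (B : set R), measurable B ->
    distribution P (X i) B = normal_prob mu sigma B.

(* Observations are numbered from 0: the first n ones are X 0, ..., X n.-1. *)
Definition sample_mean (X : nat -> T -> R) (n : nat) (w : T) : R :=
  (\sum_(i < n) X i w) / n%:R.

Definition sample_sd (X : nat -> T -> R) (n : nat) (w : T) : R :=
  Num.sqrt ((\sum_(i < n) (X i w - sample_mean X n w) ^+ 2) / n%:R).

Definition theta_hat (X : nat -> T -> R) (n : nat) (w : T) : R :=
  sample_mean X n w / sample_sd X n w.

(* Stages are numbered 1, ..., s and [D l w] is the decision variable of
   stage l; [D l w = 0] means that sampling goes on. *)
Definition accept (s : nat) (D : nat -> T -> nat) (j : nat) : set T :=
  [set w | exists l : nat, [/\ (1 <= l <= s)%N, D l w = j.+1 &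
             forall k : nat, (1 <= k < l)%N -> D k w = 0%N]].

Definition reject (m s : nat) (D : nat -> T -> nat) (i : nat) : set T :=
  [set w | exists j : nat, [/\ (j < m)%N, j <> i & accept s D j w]].

End sampling.

(* Thresholds, risks and sample sizes carry 1-based indices: th i, th' i,
   th'' i, a i, b i are used only for 1 <= i <= m.-1. *)
Section plan.
Context {R : realType}.

(* Parameter values at which the risk of rejecting H_i is controlled;
   the gaps ]th' i, th'' i[ are the indifference zones. *)
Definition varTheta (m : nat) (th' th'' : nat -> R) (i : nat) : set R :=
  if i == 0%N then [set` `]-oo, th' 1%N] ]
  else if i == m.-1 then [set` `[th'' i, +oo[ ]
  else [set` `[th'' i, th' i.+1] ].

Definition sufficient_size (m : nat) (th' th'' a b : nat -> R)
    (n : nat) : Prop :=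
  forall i, (1 <= i <= m.-1)%N ->
    student_pct n.-1 (a i) + student_pct n.-1 (b i)
      <= (th'' i - th' i) * Num.sqrt (n.-1)%:R.

Definition least_sufficient_size (m : nat) (th' th'' a b : nat -> R)
    (n : nat) : Prop :=
  [/\ (2 <= n)%N, sufficient_size m th' th'' a b n &
      forall k, (2 <= k)%N -> sufficient_size m th' th'' a b k -> (n <= k)%N].

Definition midpoint (th' th'' a b : nat -> R) (n i : nat) : R :=
  (th' i + th'' i) / 2 +
  (student_pct n.-1 (a i) - student_pct n.-1 (b i)) / (2 * Num.sqrt (n.-1)%:R).

Definition fbound (th' th'' a b : nat -> R) (n i : nat) : R :=
  Num.min (th'' i - student_pct n.-1 (b i) / Num.sqrt (n.-1)%:R)
          (midpoint th' th'' a b n i).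

Definition gbound (th' th'' a b : nat -> R) (n i : nat) : R :=
  Num.max (th' i + student_pct n.-1 (a i) / Num.sqrt (n.-1)%:R)
          (midpoint th' th'' a b n i).

(* The cases are mutually exclusive as soon as all a i and b i are at most
   1/2, so the order in which they are tried is then immaterial. *)
Definition decision (m : nat) (f g : nat -> R) (x : R) : nat :=
  if x <= f 1%N then 1%N
  else if [pick i : 'I_m | (2 <= i)%N && (g i.-1 < x <= f i)] is Some i
  then i : nat
  else if g m.-1 < x then m
  else 0%N.

End plan.

(* Main.v *)
(* Write Z_i = (X_i - mu) / sigma.  Rejecting H_i forces, at some stage and for
   some k, theta_hat > g_k although theta <= th' k, or theta_hat <= f_k although
   theta >= th'' k, so it suffices to bound the probabilities of these events
   summed over all stages.  With A = t_alpha / sqrt (n-1), B = t_beta / sqrt (n-1)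
   and D = th'' k - th' k, the gap g_k - th' k equals max (A, (D + A - B) / 2).

   The gap is at least D / 8 for every n >= 2 once zeta is small: otherwise
   A < D / 8 and B > D / 2, and since alpha and beta are comparable this bounds
   below the ratio of the Student tails beyond (D / 2) sqrt (n-1) and
   (D / 8) sqrt (n-1), a ratio which decays geometrically in n; for the finitely
   many remaining n, A itself is large.  Chernoff bounds for the sums of Z_i and
   Z_i ^ 2 therefore make the error at sample size n at most 4 r ^ n with r < 1
   independent of zeta, whatever the sample sizes are.  For each fixed n the gap
   tends to infinity as zeta tends to 0 and so the error tends to 0.  Together
   these give a sum over the stages that vanishes with zeta. *)

Require Import Defs.
From HB Require Import structures.
From mathcomp Require Import all_boot all_order all_algebra finmap.
From mathcomp Require Import all_classical all_reals all_analysis.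
From mathcomp Require Import measurable_realfun ring lra.
Set Implicit Arguments.
Unset Strict Implicit.
Unset Printing Implicit Defensive.
Import Order.TTheory GRing.Theory Num.Theory.
Import numFieldNormedType.Exports.
Local Open Scope classical_set_scope.
Local Open Scope ring_scope.

(** * Preliminaries on measurability and extended-real powers *)

Lemma measurable_superlevel d (T : measurableType d) (R : realType)
    (f : T -> R) (a : R) :
  measurable_fun setT f -> measurable [set w | a <= f w].
Proof.
move=> mf; rewrite -[mkset _]setTI.
rewrite (_ : mkset _ = f @^-1` `[a, +oo[); first exact: mf.
by apply/seteqP; split => w /=; rewrite in_itv /= andbT.
Qed.

Lemma lee_expe (R : realType) (x y : \bar R) (n : nat) :
  (0 <= x)%E -> (x <= y)%E -> (x ^+ n <= y ^+ n)%E.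
Proof.
move=> x0 xy; elim: n => [|n IH]; first by rewrite !expe0.
by rewrite !expeS lee_pmul // expe_ge0.
Qed.

(** * Expectations of products over independent observations *)

Section independence.
Context {d : measure_display} {T : measurableType d} {R : realType}.
Variables (P : probability T R) (X : nat -> {RV P >-> R}).
Hypothesis indepX : mutually_independent X.

Lemma indep_cylinder (n : nat) (B : nat -> set R) :
  (forall i, measurable (B i)) ->
  P [set w | forall i : 'I_n, B i (X i w)] =
  (\prod_(i < n) P (X i @^-1` B i))%E.
Proof.
move=> mB; pose J := [fset i in iota 0 n]%fset.
have JE i : (i \in J) = (i < n)%N by rewrite !inE mem_iota.
have -> : [set w | forall i : 'I_n, B i (X i w)] =
          \bigcap_(i in [set` J]) (X i @^-1` B i).
  apply/seteqP; split => [w /= Bw i /=|w /= Bw i].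
    by rewrite JE => lin; exact: (Bw (Ordinal lin)).
  by apply: Bw => /=; rewrite JE.
rewrite indepX // -(big_mkord xpredT (fun i => P (X i @^-1` B i))).
apply: perm_big; apply: uniq_perm; [exact: fset_uniq|exact: iota_uniq|].
by move=> i; rewrite JE /index_iota subn0 mem_iota.
Qed.

Variable Q : probability R R.
Hypothesis lawX : forall i (B : set R), measurable B ->
  distribution P (X i) B = Q B.

Import HBNNSimple.

(** Writing [g] as a finite combination of indicators of its level sets and expanding the product
    gives a sum over all assignments of levels to the [n] observations. Each assignment is a
    cylinder event, whose probability factors by independence, and the sum then folds back into a
    power. *)
Lemma integral_prod_nnsfun (g : {nnsfun R >-> R}) (n : nat) :
  (\int[P]_w (\prod_(i < n) g (X i w))%:E = (sintegral Q g) ^+ n)%E.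
Proof.
pose r : seq R := enum_fset (fset_set (range g)).
pose k := size r.
pose A (j : 'I_k) : set R := g @^-1` [set r`_j].
have mA j : measurable (A j) by exact: measurable_sfunP.
have r0 (j : 'I_k) : 0 <= r`_j.
  have : r`_j \in r by exact: mem_nth.
  by rewrite in_fset_set //; rewrite inE => -[x _ <-].
have gE x : g x = \sum_(j < k) r`_j * \1_(A j) x.
  have gr : g x \in r by rewrite in_fset_set // inE; exists x.
  have lk : (index (g x) r < k)%N by rewrite index_mem.
  rewrite (bigD1 (Ordinal lk)) //= nth_index // indicE mem_set; last first.
    by rewrite /A /= nth_index.
  rewrite mulr1 big1 ?addr0 // => j jk.
  rewrite indicE memNset ?mulr0 // /A /= => gj; move: jk; apply/negP/negPn.
  apply/eqP/val_inj => /=; rewrite gj index_uniq //; exact: fset_uniq.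
pose q (j : 'I_k) : R := fine (Q (A j)).
have qE j : (q j)%:E = Q (A j) by rewrite fineK // fin_num_measure.
have sE : sintegral Q g = (\sum_(j < k) r`_j * q j)%:E.
  rewrite sintegralE fsbig_finite //= (big_nth 0) big_mkord -sumEFin.
  by apply: eq_bigr => j _; rewrite EFinM qE.
pose C (f : {ffun 'I_n -> 'I_k}) : set T :=
  [set w | forall i : 'I_n, A (f i) (X i w)].
have CE f : measurable (C f) /\ P (C f) = (\prod_(i < n) q (f i))%:E.
  (* [indep_cylinder] takes a family indexed by all naturals, so indices from [n] on receive the
     whole line. *)
  pose B (i : nat) := if insub i is Some o then A (f o) else setT.
  have mB i : measurable (B i) by rewrite /B; case: insubP.
  have BE (i : 'I_n) : B i = A (f i) by rewrite /B valK.
  have -> : C f = [set w | forall i : 'I_n, B i (X i w)].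
    by apply/seteqP; split => w /= h i; move: (h i); rewrite BE.
  split.
    rewrite (_ : mkset _ = \bigcap_(i in [set: 'I_n]) (X i @^-1` B i)).
      apply: fin_bigcap_measurable => // i _.
      by rewrite -[_ @^-1` _]setTI; exact: measurable_funP.
    by apply/seteqP; split => w /= h i; [move=> _; exact: h|exact: h].
  rewrite indep_cylinder // -prodEFin; apply: eq_bigr => i _.
  by rewrite qE BE -(lawX i (mA _)).
have prodE w : \prod_(i < n) g (X i w) =
    \sum_(f : {ffun 'I_n -> 'I_k}) (\prod_(i < n) r`_(f i)) * \1_(C f) w.
  under eq_bigr do rewrite gE.
  rewrite bigA_distr_bigA /=; apply: eq_bigr => f _.
  rewrite big_split /=; congr (_ * _).
  rewrite [in RHS]indicE; have [|] := boolP (w \in C f).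
    rewrite inE => Cw; apply: big1 => i _.
    by rewrite indicE mem_set //; exact: Cw.
  rewrite notin_setE => /existsNP[i nAi].
  by rewrite (bigD1 i) //= indicE memNset // mul0r.
under eq_integral do rewrite prodE -sumEFin.
have r0' (f : {ffun 'I_n -> 'I_k}) : 0 <= \prod_(i < n) r`_(f i).
  exact: prodr_ge0.
rewrite ge0_integral_sum //=; last 2 first.
- move=> f; apply/measurable_EFinP; apply: measurable_funM => //.
  by apply: measurable_indic; case: (CE f).
- by move=> f w _; rewrite lee_fin mulr_ge0.
rewrite sE -EFin_expe -[in RHS](card_ord n) -prodr_const bigA_distr_bigA /=.
rewrite -sumEFin.
apply: eq_bigr => f _; have [mC PC] := CE f.
under eq_integral do rewrite EFinM.
rewrite ge0_integralZl //=; last 2 first.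
- by apply/measurable_EFinP/measurable_indic.
- by rewrite lee_fin.
by rewrite integral_indic // setIT big_split EFinM /= -PC.
Qed.

(** Monotone convergence from simple functions on the left-hand side. An inequality is enough for
    Chernoff bounds, so on the right each approximation is just bounded by the integral of [f] and
    no limit is taken there. *)
Lemma integral_prod_le (f : R -> R) (n : nat) :
  measurable_fun setT f -> (forall x, 0 <= f x) ->
  (\int[P]_w (\prod_(i < n) f (X i w))%:E <= (\int[Q]_x (f x)%:E) ^+ n)%E.
Proof.
move=> mf f0.
have mf' : measurable_fun setT (EFin \o f) by exact/measurable_EFinP.
pose g := nnsfun_approx measurableT mf'.
have f0' x : setT x -> (0 <= (EFin \o f) x)%E by rewrite /= lee_fin.
have gf k x : g k x <= f x.
  by rewrite -lee_fin /g nnsfun_approxE; exact: le_approx.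
have gcvg x : g k x @[k --> \oo] --> f x.
  exact: (fine_cvg (cvg_nnsfun_approx measurableT mf' f0' _)).
have sg k : (sintegral Q (g k) <= \int[Q]_x (f x)%:E)%E.
  rewrite -integralT_nnsfun; apply: ge0_le_integral => //.
  - by move=> x _; rewrite lee_fin.
  - exact/measurable_EFinP.
  - by move=> x _; rewrite lee_fin.
have mprod n' (h : R -> R) : measurable_fun setT h ->
    measurable_fun setT (fun w => (\prod_(i < n') h (X i w))%:E).
  move=> mh; apply/measurable_EFinP.
  by apply: measurable_prod => i _; exact: measurableT_comp.
have cvgI : (\int[P]_w (\prod_(i < n) g k (X i w))%:E @[k --> \oo] -->
             \int[P]_w (\prod_(i < n) f (X i w))%:E)%E.
  rewrite (_ : (fun w => (\prod_(i < n) f (X i w))%:E) =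
    fun w => limn (fun k => (\prod_(i < n) g k (X i w))%:E)).
    apply: cvg_monotone_convergence => //.
    - by move=> k; apply: mprod; exact: measurable_funP.
    - by move=> k w _; rewrite lee_fin prodr_ge0.
    - move=> w _ a b ab; rewrite lee_fin; apply: ler_prod => i _.
      by rewrite fun_ge0 /=; apply/lefP; exact: nd_nnsfun_approx.
  apply/funext => w; apply/esym/cvg_lim => //; apply: cvg_EFin.
    by near=> k.
  rewrite /comp /=; elim: n => [|n IHn]; last rewrite big_ord_recr.
    by rewrite big_ord0; under eq_fun do rewrite big_ord0; exact: cvg_cst.
  by under eq_fun do rewrite big_ord_recr; exact: cvgM.
rewrite -(cvg_lim _ cvgI) //; apply: lime_le; first by apply: cvgP cvgI.
near=> k; rewrite integral_prod_nnsfun.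
by apply: lee_expe => //; exact: sintegral_ge0.
Unshelve. all: by end_near. Qed.

End independence.

(** * Exponential moments of a Gaussian variable and of its square *)

Section gaussian_integrals.
Context {R : realType}.
Local Notation mu := (@lebesgue_measure R).

Import HBNNSimple.

(** The identity holds for simple functions by linearity, and both sides pass to the monotone
    limit. *)
Lemma integral_density (Q : {measure set R -> \bar R}) (p : R -> R) :
  measurable_fun setT p -> (forall x, 0 <= p x) ->
  (forall B, measurable B -> Q B = \int[mu]_(x in B) (p x)%:E)%E ->
  forall f : R -> R, measurable_fun setT f -> (forall x, 0 <= f x) ->
  (\int[Q]_x (f x)%:E = \int[mu]_x (f x * p x)%:E)%E.
Proof.
move=> mp p0 Qp f mf f0.
have mf' : measurable_fun setT (EFin \o f) by exact/measurable_EFinP.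
pose g := nnsfun_approx measurableT mf'.
have f0' x : setT x -> (0 <= (EFin \o f) x)%E by rewrite /= lee_fin.
have gcvg x : g k x @[k --> \oo] --> f x.
  exact: (fine_cvg (cvg_nnsfun_approx measurableT mf' f0' _)).
have ndg (a b : nat) (x : R) : (a <= b)%N -> g a x <= g b x.
  by move=> ab; apply/lefP; exact: nd_nnsfun_approx.
have mg k : measurable_fun setT (g k) by exact: measurable_funP.
have simple (h : {nnsfun R >-> R}) :
    (\int[Q]_x (h x)%:E = \int[mu]_x (h x * p x)%:E)%E.
  have mh y : measurable (h @^-1` [set y]) by exact: measurable_sfunP.
  rewrite integralT_nnsfun sintegralE fsbig_finite //=.
  have hE x : h x * p x =
      \sum_(y <- fset_set (range h)) y * (\1_(h @^-1` [set y]) x * p x).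
    under eq_bigr do rewrite mulrA.
    rewrite -big_distrl /=; congr (_ * _).
    by rewrite [LHS]fimfunE fsbig_finite.
  under [in RHS]eq_integral do rewrite hE -sumEFin.
  rewrite ge0_integral_sum //=; last 2 first.
  - move=> y; apply/measurable_EFinP; apply: measurable_funM => //.
    apply: measurable_funM; [apply: measurable_indic|exact: mp].
    exact: mh.
  - move=> y x _; rewrite lee_fin mulrA mulr_ge0 //.
    rewrite indicE; have [|] := boolP (x \in _); last by rewrite mulr0.
    by rewrite inE mulr1 => /= <-.
  apply: eq_big_seq => y; rewrite in_fset_set // inE => -[x0 _ yE].
  have y0 : 0 <= y by rewrite -yE.
  under [in RHS]eq_integral do rewrite EFinM.
  rewrite ge0_integralZl //=; last 2 first.
  - apply/measurable_EFinP; apply: measurable_funM => //.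
    by apply: measurable_indic; exact: mh.
  - by move=> x _; rewrite lee_fin mulr_ge0.
  congr (_ * _)%E; rewrite Qp // integral_mkcond; apply: eq_integral => x _.
  rewrite patchE indicE; case: ifP => _; by rewrite ?mul1r ?mul0r.
have lhs : (\int[Q]_x (g k x)%:E @[k --> \oo] --> \int[Q]_x (f x)%:E)%E.
  rewrite (_ : (fun x => (f x)%:E) = fun x => limn (fun k => (g k x)%:E)).
    apply: cvg_monotone_convergence => //.
    - by move=> k; apply/measurable_EFinP; exact: measurable_funP.
    - by move=> k x _; rewrite lee_fin.
    - by move=> x _ a b ab; rewrite lee_fin; exact: ndg.
  apply/funext => w; apply/esym/cvg_lim => //; apply: cvg_EFin.
    by near=> k.
  exact: gcvg.
have rhs : (\int[mu]_x (g k x * p x)%:E @[k --> \oo] -->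
            \int[mu]_x (f x * p x)%:E)%E.
  rewrite (_ : (fun x => (f x * p x)%:E) =
               fun x => limn (fun k => (g k x * p x)%:E)).
    apply: cvg_monotone_convergence => //.
    - move=> k; apply/measurable_EFinP; apply: measurable_funM; last exact: mp.
      exact: mg.
    - by move=> k x _; rewrite lee_fin mulr_ge0.
    - move=> x _ a b ab; rewrite lee_fin ler_wpM2r //.
      exact: ndg.
  apply/funext => w; apply/esym/cvg_lim => //; apply: cvg_EFin.
    by near=> k.
  by apply: cvgM; [exact: gcvg|exact: cvg_cst].
rewrite -(cvg_lim _ lhs) // -(cvg_lim _ rhs) //.
by congr (limn _); apply/funext => k; exact: simple.
Unshelve. all: by end_near. Qed.

Variables (m s : R).
Hypothesis s0 : 0 < s.
Variable Q : probability R R.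
Hypothesis QE : forall B : set R, measurable B -> Q B = normal_prob m s B.

Lemma integral_normal_probE (f : R -> R) :
  measurable_fun setT f -> (forall x, 0 <= f x) ->
  (\int[Q]_x (f x)%:E =
   \int[mu]_x (f x * normal_pdf m s x)%:E)%E.
Proof.
apply: integral_density.
- exact: measurable_normal_pdf.
- exact: normal_pdf_ge0.
- exact: QE.
Qed.

(** Completing the square: the exponential tilt moves the mean from [m] to [m + l * s] and leaves
    the constant [expR (l ^+ 2 / 2)], while the tilted density still has mass 1. *)
Lemma normal_mgf (l : R) :
  (\int[Q]_x (expR (l * ((x - m) / s)))%:E =
   (expR (l ^+ 2 / 2))%:E)%E.
Proof.
have sN0 : s != 0 by rewrite gt_eqF.
rewrite integral_normal_probE; last 2 first.
- apply: measurableT_comp => //; apply: measurable_funM => //.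
  by apply: measurable_funM => //; exact: measurable_funB.
- by move=> x; exact: expR_ge0.
have E x : expR (l * ((x - m) / s)) * normal_pdf m s x =
           expR (l ^+ 2 / 2) * normal_pdf (m + l * s) s x.
  rewrite !normal_pdfE // /normal_fun.
  rewrite mulrCA [RHS]mulrCA -!expRD; congr (_ * expR _).
  by rewrite -mulr_natr; field.
under eq_integral do rewrite E EFinM.
rewrite ge0_integralZl //=.
- by rewrite integral_normal_pdf mule1.
- by apply/measurable_EFinP; exact: measurable_normal_pdf.
- by move=> x _; rewrite lee_fin normal_pdf_ge0.
Qed.

(** Tilting by the square keeps the mean and rescales the standard deviation to
    [s / Num.sqrt (1 - c)]; the constant is the ratio of the two peaks. *)
Lemma normal_square_mgf (c : R) : c < 1 ->
  (\int[Q]_x (expR (c / 2 * ((x - m) / s) ^+ 2))%:E =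
   (Num.sqrt (1 - c))^-1%:E)%E.
Proof.
move=> c1; have sN0 : s != 0 by rewrite gt_eqF.
have c0 : 0 < 1 - c by rewrite subr_gt0.
rewrite integral_normal_probE; last 2 first.
- apply: measurableT_comp => //; apply: measurable_funM => //.
  apply: measurable_funX => //.
  by apply: measurable_funM => //; exact: measurable_funB.
- by move=> x; exact: expR_ge0.
pose r := Num.sqrt (1 - c).
have r0 : 0 < r by rewrite sqrtr_gt0.
have r2 : r ^+ 2 = 1 - c by rewrite sqr_sqrtr // ltW.
have sr0 : s / r != 0 by rewrite gt_eqF // divr_gt0.
have peakE : normal_peak s = r^-1 * normal_peak (s / r).
  rewrite /normal_peak -!(mulr_natr (_ * pi)) -!(mulrA (_ ^+ 2)).
  rewrite !(@sqrtrM _ (_ ^+ 2)) ?sqr_ge0 // !sqrtr_sqr.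
  rewrite !gtr0_norm // ?divr_gt0 // !invfM invrK; field.
  by rewrite !gt_eqF // sqrtr_gt0 mulr_gt0 ?pi_gt0.
have E x : expR (c / 2 * ((x - m) / s) ^+ 2) * normal_pdf m s x =
           r^-1 * normal_pdf m (s / r) x.
  rewrite !normal_pdfE // /normal_fun peakE.
  rewrite mulrCA -!mulrA -expRD; congr (_ * (_ * expR _)).
  have -> : (s / r) ^+ 2 = s ^+ 2 / (1 - c) by rewrite expr_div_n r2.
  rewrite -[s ^+ 2 *+ 2]mulr_natr -[(_ / (1 - c)) *+ 2]mulr_natr.
  by move: (x - m) => y; field; rewrite sN0 gt_eqF.
under eq_integral do rewrite E EFinM.
rewrite ge0_integralZl //=.
- by rewrite integral_normal_pdf mule1.
- by apply/measurable_EFinP; exact: measurable_normal_pdf.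
- by move=> x _; rewrite lee_fin normal_pdf_ge0.
- by rewrite lee_fin invr_ge0 ltW.
Qed.

End gaussian_integrals.

(** Markov's inequality in exponential form: the indicator of a nonnegative sum is at most the
    exponential of that sum, which is a product over the observations. *)
Lemma chernoff_iid d (T : measurableType d) (R : realType)
    (P : probability T R) (X : nat -> {RV P >-> R}) (Q : probability R R)
    (h : R -> R) (n : nat) :
  mutually_independent X ->
  (forall i (B : set R), measurable B -> distribution P (X i) B = Q B) ->
  measurable_fun setT h ->
  (P [set w | (0 <= \sum_(i < n) h (X i w))%R] <=
   (\int[Q]_x (expR (h x))%:E) ^+ n)%E.
Proof.
move=> iX lX mh.
have mS : measurable_fun setT (fun w => \sum_(i < n) h (X i w)).
  by apply: measurable_sum => i; exact: measurableT_comp.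
have mA : measurable [set w | 0 <= \sum_(i < n) h (X i w)].
  exact: measurable_superlevel.
have me : measurable_fun setT (expR \o h) by exact: measurableT_comp.
have e0 x : 0 <= (expR \o h) x by exact: expR_ge0.
apply: le_trans (integral_prod_le iX lX n me e0).
rewrite -[mkset _]setIT -integral_indic //.
apply: ge0_le_integral => //.
- by apply/measurable_EFinP; exact: measurable_indic.
- apply/measurable_EFinP.
  by apply: measurable_prod => i _; exact: measurableT_comp.
move=> w _; rewrite lee_fin -[X in _ <= X]/(\prod_(i < n) expR (h (X i w))).
rewrite -expR_sum indicE; have [|] := boolP (w \in _) => /= [|_].
  by rewrite inE /= => hw; rewrite -[X in X <= _]expR0 ler_expR.
exact: expR_ge0.
Qed.

(** * Exponential concentration of the sums of Z_i and of Z_i ^ 2 *)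

Section gaussian_concentration.
Context {R : realType}.

Definition standardize (mu sigma x : R) : R := (x - mu) / sigma.

Lemma measurable_standardize mu sigma :
  measurable_fun setT (standardize mu sigma).
Proof. by apply: measurable_funM => //; exact: measurable_funB. Qed.

(** One form for both sums: [b2 = 0] gives the linear one and [b1 = 0] the quadratic one, with the
    exponential moment [v] supplied by the caller. The level [n%:R * c] is spread over the summands,
    which produces the factor [expR (- c)]. *)
Lemma chernoff_gaussian (b1 b2 c v mu sigma : R) d (T : measurableType d)
    (P : probability T R) (X : nat -> {RV P >-> R}) (n : nat) :
  (\int[distribution P (X 0%N)]_x
     (expR (b1 * standardize mu sigma x + b2 * standardize mu sigma x ^+ 2))%:E
   = v%:E)%E ->
  iid_gaussian X mu sigma ->
  (P [set w | (n%:R * c <= \sum_(i < n) (b1 * standardize mu sigma (X i w) +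
      b2 * standardize mu sigma (X i w) ^+ 2))%R] <=
   ((v * expR (- c)) ^+ n)%:E)%E.
Proof.
move=> Iv [iX lX].
pose h x : R := b1 * standardize mu sigma x + b2 * standardize mu sigma x ^+ 2.
have mh : measurable_fun setT h.
  apply: measurable_funD; apply: measurable_funM => //.
    exact: measurable_standardize.
  by apply: measurable_funX; exact: measurable_standardize.
have mh' : measurable_fun setT (fun x => h x - c) by exact: measurable_funB.
have lX' i (B : set R) : measurable B ->
    distribution P (X i) B = distribution P (X 0%N) B.
  by move=> mB; rewrite !lX.
have := chernoff_iid n iX lX' mh'.
rewrite (_ : \int[_]_x _ = (v * expR (- c))%:E)%E; last first.
  under eq_integral do rewrite expRD EFinM.
  rewrite ge0_integralZr //=.
  - by rewrite Iv EFinM.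
  - by apply/measurable_EFinP; exact: measurableT_comp.
rewrite EFin_expe; apply: le_trans; rewrite le_eqVlt; apply/orP; left; apply/eqP.
congr (P _); apply/funext => w /=; apply/propext.
by rewrite sumrB sumr_const card_ord -[c *+ n]mulr_natl subr_ge0.
Qed.

(** This [c] gives [c * (1 + e) = e / 2]. After squaring, the claim is [expR (- (e / 2)) < 1 - c],
    which follows from [expR (- x) <= (1 + x)^-1]. *)
Lemma chernoff_upper_lt1 (e : R) : 0 < e -> let c := e / (2 * (1 + e)) in
  c < 1 /\ (Num.sqrt (1 - c))^-1 * expR (- (c / 2 * (1 + e))) < 1.
Proof.
move=> e0 c; have e1 : 0 < 1 + e by lra.
have cE : c * (1 + e) = e / 2 by rewrite /c; field; rewrite gt_eqF.
have c0 : 0 < c by rewrite divr_gt0 // mulr_gt0.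
have c1 : c < 1 by nra.
split=> //; rewrite mulrC ltr_pdivrMr ?sqrtr_gt0 ?subr_gt0 // mul1r.
rewrite -(@ltr_pXn2r _ 2) ?nnegrE ?expR_ge0 ?sqrtr_ge0 //.
rewrite sqr_sqrtr ?subr_ge0 1?ltW // -expRM_natl.
have -> : 2%:R * - (c / 2 * (1 + e)) = - (e / 2) by rewrite -cE; field.
rewrite expRN; apply: (@le_lt_trans _ _ (1 + e / 2)^-1).
  rewrite lef_pV2 ?posrE ?expR_gt0 ?expR_ge1Dx //; lra.
rewrite -[ltLHS]mul1r ltr_pdivrMr; last lra.
nra.
Qed.

(** Here the tilt is [- c]. After squaring, the claim is [expR (c * (1 - e)) < 1 + c], and the left
    side is at most [(1 - c * (1 - e))^-1]. *)
Lemma chernoff_lower_lt1 (e : R) : 0 < e < 1 -> forall c, c = e / 2 ->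
  (Num.sqrt (1 - - c))^-1 * expR (c / 2 * (1 - e)) < 1.
Proof.
move=> /andP[e0 e1] c cE; rewrite opprK.
have c0 : 0 < c by rewrite cE divr_gt0.
have c1 : 0 < 1 + c by lra.
rewrite mulrC ltr_pdivrMr ?sqrtr_gt0 // mul1r.
rewrite -(@ltr_pXn2r _ 2) ?nnegrE ?expR_ge0 ?sqrtr_ge0 //.
rewrite sqr_sqrtr 1?ltW // -expRM_natl.
have -> : 2%:R * (c / 2 * (1 - e)) = c * (1 - e) by field.
rewrite -[expR _]invrK -expRN.
have ec : 2 * c = e by rewrite cE; field.
have q0 : 0 < 1 - c * (1 - e) by nra.
apply: (@le_lt_trans _ _ (1 - c * (1 - e))^-1).
  by rewrite lef_pV2 ?posrE ?expR_gt0 ?expR_ge1Dx.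
rewrite -[ltLHS]mul1r ltr_pdivrMr //.
nra.
Qed.

(** The rate [r] is chosen before the probability space, [mu], [sigma] and [n]; it is the largest of
    the Chernoff bases of four one-sided deviations, whence the factor 4. *)
Lemma gaussian_concentration (e : R) : 0 < e < 1 ->
  exists2 r : R, 0 < r < 1 &
  forall d (T : measurableType d) (P : probability T R)
    (X : nat -> {RV P >-> R}) (mu sigma : R) (n : nat),
  0 < sigma -> iid_gaussian X mu sigma ->
  (P [set w | (n%:R * e <= `|\sum_(i < n) standardize mu sigma (X i w)|)%R \/
     (n%:R * e <=
      `|\sum_(i < n) standardize mu sigma (X i w) ^+ 2 - n%:R|)%R] <=
   (4 * r ^+ n)%:E)%E.
Proof.
move=> /andP[e0 e1].
have [c1 U] := chernoff_upper_lt1 e0; have := @chernoff_lower_lt1 e.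
rewrite e0 e1 => /(_ isT _ erefl) L.
set c := e / (2 * (1 + e)) in c1 U.
set u := _ * _ in U; set l := _ * _ in L; pose k := expR (- (e ^+ 2 / 2)).
have k1 : k < 1 by rewrite /k expRN invf_lt1 ?expR_gt0 // expR_gt1 divr_gt0 ?exprn_gt0.
exists (Num.max k (Num.max u l)).
  by rewrite !gt_max !lt_max expR_gt0 k1 U L.
set r := Num.max _ _.
have kr : k <= r by rewrite /r le_max lexx.
have ur : u <= r by rewrite /r !le_max lexx orbT.
have lr : l <= r by rewrite /r !le_max lexx !orbT.
have u0 : 0 <= u by rewrite mulr_ge0 ?expR_ge0 // invr_ge0 sqrtr_ge0.
have l0 : 0 <= l by rewrite mulr_ge0 ?expR_ge0 // invr_ge0 sqrtr_ge0.
have k0 : 0 <= k by exact: expR_ge0.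
move=> d T P X mu sigma n s0 iX; have [_ lX] := iX.
pose z i w := standardize mu sigma (X i w).
pose S1 w := \sum_(i < n) z i w; pose S2 w := \sum_(i < n) z i w ^+ 2.
have mz i : measurable_fun setT (z i).
  by apply: measurableT_comp => //; exact: measurable_standardize.
have mS1 : measurable_fun setT S1 by apply: measurable_sum => i.
have mS2 : measurable_fun setT S2.
  by apply: measurable_sum => i; exact: measurable_funX.
have lX0 (B : set R) : measurable B ->
  distribution P (X 0%N) B = normal_prob mu sigma B by move=> mB; exact: lX.
have lin b : b ^+ 2 = e ^+ 2 ->
    (P [set w | (n%:R * e ^+ 2 <= b * S1 w)%R] <= (r ^+ n)%:E)%E.
  move=> be; have := @chernoff_gaussian b 0 (e ^+ 2) (expR (b ^+ 2 / 2))
    mu sigma d T P X n _ iX.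
  rewrite -expRD be (_ : e ^+ 2 / 2 + - e ^+ 2 = - (e ^+ 2 / 2)); last by field.
  rewrite (_ : mkset _ = mkset (fun w => n%:R * e ^+ 2 <= b * S1 w)); last first.
    apply/funext => w /=; congr (is_true (_ <= _)); rewrite mulr_sumr.
    by apply: eq_bigr => i _; rewrite mul0r addr0.
  move=> H; apply: le_trans (H _) _; last first.
    by rewrite lee_fin lerXn2r ?nnegrE // (le_trans _ kr).
  rewrite -be -(normal_mgf s0 lX0 b); apply: eq_integral => x _.
  by rewrite mul0r addr0.
have quad b a v : b < 1 ->
    (Num.sqrt (1 - b))^-1 * expR (- (b / 2 * a)) = v -> v <= r -> 0 <= v ->
    (P [set w | (n%:R * (b / 2 * a) <= b / 2 * S2 w)%R] <= (r ^+ n)%:E)%E.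
  move=> b1 vE vr v0; have := @chernoff_gaussian 0 (b / 2) (b / 2 * a)
    (Num.sqrt (1 - b))^-1 mu sigma d T P X n _ iX.
  rewrite (_ : mkset _ = mkset (fun w => n%:R * (b / 2 * a) <= b / 2 * S2 w));
    last first.
    apply/funext => w /=; congr (is_true (_ <= _)); rewrite mulr_sumr.
    by apply: eq_bigr => i _; rewrite mul0r add0r.
  rewrite vE => H; apply: le_trans (H _) _; last first.
    by rewrite lee_fin lerXn2r ?nnegrE // (le_trans _ vr).
  rewrite -(normal_square_mgf s0 lX0 b1); apply: eq_integral => x _.
  by rewrite mul0r add0r.
(* The two absolute values split into four one-sided events. The tilt in [A4] is negative, so a
   lower deviation of [S2] becomes an upper one. *)
pose A1 := [set w | n%:R * e ^+ 2 <= e * S1 w].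
pose A2 := [set w | n%:R * e ^+ 2 <= - e * S1 w].
pose A3 := [set w | n%:R * (c / 2 * (1 + e)) <= c / 2 * S2 w].
pose A4 := [set w | n%:R * (- (e / 2) / 2 * (1 - e)) <= - (e / 2) / 2 * S2 w].
have mA1 : measurable A1 by apply: measurable_superlevel; exact: measurable_funM.
have mA2 : measurable A2 by apply: measurable_superlevel; exact: measurable_funM.
have mA3 : measurable A3 by apply: measurable_superlevel; exact: measurable_funM.
have mA4 : measurable A4 by apply: measurable_superlevel; exact: measurable_funM.
have P1 : (P A1 <= (r ^+ n)%:E)%E by exact: lin.
have P2 : (P A2 <= (r ^+ n)%:E)%E by apply: lin; rewrite sqrrN.
have P3 : (P A3 <= (r ^+ n)%:E)%E by exact: (quad c (1 + e) u).
have P4 : (P A4 <= (r ^+ n)%:E)%E.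
  apply: (quad _ _ l) => //; first lra.
  by rewrite /l; congr (_ * expR _); field.
have c0 : 0 < c by rewrite divr_gt0 // mulr_gt0 // addr_gt0.
apply: (@le_trans _ _ (P ((A1 `|` A2) `|` (A3 `|` A4)))).
  apply: le_measure; rewrite ?inE.
  - have -> : [set w | n%:R * e <= `|\sum_(i < n) standardize mu sigma (X i w)| \/
     n%:R * e <=
      `|\sum_(i < n) standardize mu sigma (X i w) ^+ 2 - n%:R| ] =
      [set w | n%:R * e <= `|S1 w|] `|` [set w | n%:R * e <= `|S2 w - n%:R|] by [].
    apply: measurableU; apply: measurable_superlevel; apply: measurableT_comp => //.
    exact: measurable_funB.
  - by apply: measurableU; exact: measurableU.
  move=> w /= [|]; rewrite -/(S1 w) -/(S2 w) ler_normr => /orP[] H.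
  - by left; left; rewrite /A1 /= expr2 mulrA [leRHS]mulrC ler_pM2r.
  - left; right; rewrite /A2 /= expr2 mulrA mulNr -mulrN [leRHS]mulrC.
    by rewrite ler_pM2r.
  - right; left; rewrite /A3 /= mulrCA ler_pM2l ?divr_gt0 //; lra.
  - right; right; rewrite /A4 /= mulrCA ler_nM2l; last first.
      by rewrite pmulr_llt0 ?invr_gt0 // oppr_lt0 divr_gt0.
    lra.
apply: le_trans (measureU2 _ _ _) _; [exact: measurableU..|].
apply: le_trans (leeD (measureU2 _ _ _) (measureU2 _ _ _)) _ => //.
apply: le_trans (leeD (leeD P1 P2) (leeD P3 P4)) _.
by rewrite -!EFinD lee_fin; lra.
Qed.

End gaussian_concentration.

(** * The studentised mean in terms of standardised observations *)

Section studentized_mean.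
Context {d : measure_display} {T : measurableType d} {R : realType}.

Lemma measurable_theta_hat (X : nat -> T -> R) (n : nat) :
  (forall i, measurable_fun setT (X i)) ->
  measurable_fun setT (theta_hat X n).
Proof.
move=> mX.
have mM : measurable_fun setT (sample_mean X n).
  by apply: measurable_funM => //; exact: measurable_sum.
have mS : measurable_fun setT (sample_sd X n).
  apply: (measurableT_comp (continuous_measurable_fun (@sqrt_continuous R))).
  apply: measurable_funM => //; apply: measurable_sum => i.
  by apply: measurable_funX; exact: measurable_funB.
(* powR turns the inverse into a power, also where the deviation vanishes:
   0 `^ (- 1) = 0 = 0^-1. *)
rewrite (_ : theta_hat X n =
  fun w => sample_mean X n w * sample_sd X n w `^ (- 1)).
  apply: measurable_funM => //.
  exact: (measurableT_comp (measurable_powR _)).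
by apply/funext => w; rewrite powR_inv1 // sqrtr_ge0.
Qed.

Variables (X : nat -> T -> R) (mu sigma : R) (n : nat) (w : T).
Hypotheses (sigma0 : 0 < sigma) (n0 : (0 < n)%N).

Let z i := standardize mu sigma (X i w).
Let zbar := (\sum_(i < n) z i) / n%:R.
Let q := (\sum_(i < n) z i ^+ 2) / n%:R.

Let nR0 : n%:R != 0 :> R.
Proof. by rewrite pnatr_eq0 -lt0n. Qed.

Lemma sample_mean_standardize :
  sample_mean X n w = sigma * (zbar + mu / sigma).
Proof.
rewrite /zbar /z /standardize -mulr_suml sumrB sumr_const card_ord.
rewrite /sample_mean -mulr_natr.
by field; rewrite nR0 gt_eqF.
Qed.

Lemma sum_sqr_deviation :
  \sum_(i < n) (z i - zbar) ^+ 2 = n%:R * (q - zbar ^+ 2).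
Proof.
under eq_bigr do rewrite sqrrB.
rewrite big_split sumrB /= sumr_const card_ord -mulr_natr.
rewrite sumrMnl -mulr_suml.
have -> : \sum_(i < n) z i = zbar * n%:R by rewrite /zbar divfK.
have -> : \sum_(i < n) z i ^+ 2 = q * n%:R by rewrite /q divfK.
by ring.
Qed.

(** The scale [sigma] cancels between mean and deviation, so the parameters enter only through
    [mu / sigma] and the Z_i. *)
Lemma theta_hat_standardize :
  theta_hat X n w = (zbar + mu / sigma) / Num.sqrt (q - zbar ^+ 2).
Proof.
rewrite /theta_hat /sample_sd sample_mean_standardize.
under eq_bigr => i _.
  rewrite (_ : X i w - _ = sigma * (z i - zbar)); last first.
    by rewrite /z /standardize; field; rewrite gt_eqF.
  rewrite exprMn; over.
rewrite -mulr_sumr sum_sqr_deviation [n%:R * _]mulrC mulrA mulfK //.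
rewrite sqrtrM ?sqr_ge0 // sqrtr_sqr gtr0_norm // -mulf_div divff ?mul1r //.
by rewrite gt_eqF.
Qed.

(** Two of the squared deviations already bound the sample variance from below, by
    [(x - y) ^+ 2 <= 2 * (x ^+ 2 + y ^+ 2)]. This controls small denominators at a fixed sample
    size. *)
Lemma pair_deviation_le : (2 <= n)%N ->
  (z 0 - z 1) ^+ 2 <= 2 * (n%:R * (q - zbar ^+ 2)).
Proof.
move=> n2; rewrite -sum_sqr_deviation.
rewrite -(big_mkord xpredT (fun i => (z i - zbar) ^+ 2)).
rewrite big_ltn // big_ltn // addrA.
set S := \sum_(_ <= _ < _) _; have S0 : 0 <= S.
  by apply: sumr_ge0 => i _; exact: sqr_ge0.
have := sqr_ge0 ((z 0 - zbar) + (z 1 - zbar)).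
nra.
Qed.

End studentized_mean.

(** The hypotheses put [s] within [2 * e] of 1, so replacing [th0 + h] by [(th0 + h) * s] costs at
    most [2 * e * |th0 + h|]. The slack [h] pays for this and for [zb]. *)
Lemma studentized_lt (R : realFieldType) (zb s th th0 h e : R) :
  0 < e < 4^-1 -> e * (1 + 2 * `|th0 + h|) < h -> th <= th0 ->
  `|zb| < e -> 0 <= s -> `|s ^+ 2 - (1 - zb ^+ 2)| < e ->
  (zb + th) / s < th0 + h.
Proof.
move=> /andP[e0 e4] eh tt zbe s0 se.
have zb2 : zb ^+ 2 < e ^+ 2.
  by rewrite -(real_normK (num_real zb)) ltr_pXn2r ?nnegrE // ltW.
move: zbe se; rewrite !ltr_norml => /andP[zb1 zb3] /andP[s1 s2].
(* If [s] were 0, then [1 - zb ^+ 2] would be below [e], which is impossible for [e < 1 / 4]. *)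
have sp : 0 < s by rewrite lt_neqAle s0 andbT; apply/eqP => s0'; nra.
rewrite ltr_pdivrMr //.
have b0 := sqr_ge0 zb.
have s3 : s - 1 <= 2 * e by nra.
have s4 : - (2 * e) <= s - 1 by nra.
have : - (2 * e * `|th0 + h|) <= (th0 + h) * (s - 1).
  rewrite lerNl -mulrN; apply: le_trans (ler_norm _) _.
  rewrite normrM mulrC ler_wpM2r // normrN ler_norml.
  by rewrite s4 s3.
nra.
Qed.

(** * Tail bounds for the studentised mean *)

Section gaussian_tails.
Context {R : realType}.

(** The sign [e] treats both tails at once. Off the exceptional event of [gaussian_concentration],
    [studentized_lt] excludes the deviation. *)
Lemma theta_hat_tail (th0 h e : R) : 0 < h -> e ^+ 2 = 1 ->
  exists2 r : R, 0 < r < 1 &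
  forall d (T : measurableType d) (P : probability T R)
    (X : nat -> {RV P >-> R}) (mu sigma : R) (n : nat),
  (0 < n)%N -> 0 < sigma -> iid_gaussian X mu sigma ->
  e * (mu / sigma) <= th0 ->
  (P [set w | (th0 + h <= e * theta_hat X n w)%R] <= (4 * r ^+ n)%:E)%E.
Proof.
move=> h0 e2.
pose D := 1 + 2 * `|th0 + h|.
have D0 : 0 < D by rewrite ltr_pwDl ?mulr_ge0.
(* Small enough for both conditions of [studentized_lt]: [c < 1 / 4] and [c * D < h]. *)
pose c := Num.min 8^-1 (h / D / 2).
have c0 : 0 < c by rewrite lt_min invr_gt0 ltr0n /= !divr_gt0.
have c1 : c <= 8^-1 by rewrite ge_min lexx.
have cD : c * D < h.
  have : c <= h / D / 2 by rewrite ge_min lexx orbT.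
  rewrite -(ler_pM2r D0) [h / D / 2 * D]mulrAC divfK ?gt_eqF //; lra.
have cc : 0 < c < 1 by rewrite c0 /=; lra.
have [r r01 Hr] := gaussian_concentration cc; exists r => //.
move=> d T P X mu sigma n n0 s0 iX tt.
apply: le_trans (Hr _ _ _ _ _ _ n s0 iX).
have mz i : measurable_fun setT (fun w => standardize mu sigma (X i w)).
  by apply: measurableT_comp => //; exact: measurable_standardize.
apply: le_measure; rewrite ?inE.
- apply: measurable_superlevel; apply: measurable_funM => //.
  by apply: measurable_theta_hat => i.
- apply: (@measurableU _ _ (mkset _) (mkset _)); apply: measurable_superlevel.
    by apply: measurableT_comp => //; exact: measurable_sum.
  apply: measurableT_comp => //; apply: measurable_funB => //.
  by apply: measurable_sum => i; exact: measurable_funX.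
move=> w /= H; apply: contrapT => /not_orP[/negP + /negP]; rewrite -!ltNge.
set S1 := \sum_(i < n) _; set S2 := \sum_(i < n) _ => B1 B2.
move: H; apply/negP; rewrite -ltNge (theta_hat_standardize X mu w s0 n0).
rewrite -/S1 -/S2 mulrA mulrDr.
have nR : 0 < n%:R :> R by rewrite ltr0n.
have eN : `|e| = 1.
  by apply/eqP; rewrite -(@eqrXn2 _ 2) // real_normK ?num_real // e2 expr1n.
have B1' : `|e * (S1 / n%:R)| < c.
  by rewrite !normrM eN mul1r normfV [ `|n%:R| ]gtr0_norm // ltr_pdivrMr // mulrC.
have B2' : `|S2 / n%:R - 1| < c.
  have -> : S2 / n%:R - 1 = (S2 - n%:R) / n%:R by field; rewrite gt_eqF.
  by rewrite normrM normfV [ `|n%:R| ]gtr0_norm // ltr_pdivrMr // mulrC.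
have sq : (e * (S1 / n%:R)) ^+ 2 = (S1 / n%:R) ^+ 2 by rewrite exprMn e2 mul1r.
apply: (@studentized_lt _ _ _ _ _ _ c) => //; first by rewrite c0 /=; lra.
rewrite sq; set v := S2 / n%:R - (S1 / n%:R) ^+ 2.
(* [Num.sqrt] is 0 on negative arguments, so its square gives back [v] only once [v >= 0]; here [v]
   exceeds [1 - c - c ^+ 2]. *)
have v0 : 0 <= v.
  move: B1' B2' sq; rewrite /v !ltr_norml => /andP[a1 a2] /andP[a3 a4] <-; nra.
rewrite sqr_sqrtr // /v.
by rewrite (_ : _ - (1 - _) = S2 / n%:R - 1) //; ring.
Qed.

(** By independence the law of the pair agrees on rectangles with the product of the marginals,
    hence everywhere. For a fixed first coordinate the event is an interval of length [2 * e], on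
    which the density is at most its peak. *)
Lemma gaussian_pair_close d (T : measurableType d) (P : probability T R)
    (X : nat -> {RV P >-> R}) (mu sigma e : R) :
  0 < sigma -> 0 < e -> iid_gaussian X mu sigma ->
  (P [set w | (`|X 0%N w - X 1%N w| <= e)%R] <=
   (normal_peak sigma * (2 * e))%:E)%E.
Proof.
move=> s0 e0 [iX lX].
have mphi : measurable_fun setT (fun w => (X 0%N w, X 1%N w)).
  exact: measurable_fun_pair.
pose phi_mixin := isMeasurableFun.Build _ _ _ _ _ mphi.
pose phi : {mfun T >-> (R * R)%type} := HB.pack (fun w => (X 0%N w, X 1%N w)) phi_mixin.
pose Q : probability R R := distribution P (X 0%N).
have QN (B : set R) : measurable B -> Q B = normal_prob mu sigma B.
  exact: lX.
pose S := [set u : R * R | `|u.1 - u.2| <= e].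
have mS : measurable S.
  rewrite -[S]setTI (_ : S = (fun u => `|u.1 - u.2|) @^-1` `]-oo, e]).
    have : measurable_fun setT (fun u : R * R => `|u.1 - u.2|).
      by apply: measurableT_comp => //; exact: measurable_funB.
    exact.
  by apply/seteqP; split => w /=; rewrite in_itv.
have rect (A B : set R) : measurable A -> measurable B ->
    (distribution P phi (A `*` B) = Q A * Q B)%E.
  move=> mA mB; pose C i := if i == 0%N then A else B.
  have mC i : measurable (C i) by rewrite /C; case: ifP.
  have := indep_cylinder iX 2 mC.
  rewrite !big_ord_recl big_ord0 mule1 /=.
  have -> : P (X (bump 0 0) @^-1` C (bump 0 0)) = Q B.
    by rewrite QN // -(lX 1%N).
  move=> <-; congr (P _); apply/seteqP; split => w /=.
    by move=> [a b] [[|[|//]] ?] /=.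
  by move=> h; split; [exact: (h ord0)|exact: (h (lift ord0 ord0))].
have -> : P [set w | `|X 0%N w - X 1%N w| <= e] = distribution P phi S by [].
rewrite -(product_measure_unique rect) // /product_measure1.
apply: (@le_trans _ _ (\int[Q]_x (normal_peak sigma * (2 * e))%:E)%E).
  apply: ge0_le_integral => //.
  - exact: measurable_fun_xsection.
  move=> x _ /=; rewrite [leLHS]QN; last exact: measurable_xsection.
  have -> : xsection S x = `[x - e, x + e]%classic.
    apply/seteqP; split => y; rewrite /xsection /= inE /S /= in_itv /= ler_distlC.
      by rewrite andbC => /andP[? ?]; apply/andP; split; lra.
    by move=> /andP[? ?]; apply/andP; split; lra.
  rewrite /normal_prob.
  apply: (@le_trans _ _ (\int[lebesgue_measure]_(y in `[(x - e)%R, (x + e)%R])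
     (normal_peak sigma)%:E)%E).
    apply: ge0_le_integral => //.
    - by move=> y _; rewrite lee_fin normal_pdf_ge0.
    - apply/measurable_EFinP; apply: measurable_funTS.
      exact: measurable_normal_pdf.
    - by move=> y _; rewrite lee_fin normal_pdf_ub // gt_eqF.
  rewrite integral_cst //= lebesgue_measure_itv /= lte_fin.
  rewrite ifT; last lra.
  by rewrite -EFinB -EFinM lee_fin ler_wpM2l ?normal_peak_ge0 //; lra.
have QT : Q [set: R] = 1%E by exact: (@probability_setT _ _ _ Q).
by rewrite integral_cst // [X in (_ * X)%E]QT mule1.
Qed.

(** Meant for the finitely many small sample sizes, where an exponential bound in [n] says too
    little: a high enough threshold makes the error small uniformly over the admissible [mu] and
    [sigma]. *)
Lemma theta_hat_bounded_in_prob (th0 e c : R) (n : nat) :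
  e ^+ 2 = 1 -> (2 <= n)%N -> 0 < c ->
  exists K : R, forall d (T : measurableType d) (P : probability T R)
    (X : nat -> {RV P >-> R}) (mu sigma k : R),
  0 < sigma -> iid_gaussian X mu sigma -> e * (mu / sigma) <= th0 -> K <= k ->
  (P [set w | (k <= e * theta_hat X n w)%R] <= c%:E)%E.
Proof.
move=> e2 n2 c0.
have n0 : (0 < n)%N by exact: ltnW.
have nR : 0 < n%:R :> R by rewrite ltr0n.
have eN : `|e| = 1.
  by apply/eqP; rewrite -(@eqrXn2 _ 2) // real_normK ?num_real // e2 expr1n.
(* Since n s_n ^ 2 >= (Z_0 - Z_1) ^ 2 / 2, the statistic can be large only if
   the mean is large or X_0 and X_1 are close. *)
pose M : R := Num.sqrt (2 * (4 / c)).
(* With this value the Chernoff base [expR (- (M ^+ 2 / 2))] is [expR (- (4 / c))], which is at most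
   [c / 4]. *)
have M2 : M ^+ 2 = 2 * (4 / c) by rewrite sqr_sqrtr // mulr_ge0 // divr_ge0 // ltW.
have M0 : 0 < M by rewrite sqrtr_gt0 mulr_gt0 // divr_gt0.
pose L := M + `|th0|.
have L0 : 0 < L by rewrite ltr_pwDl.
pose a := c / 8.
have a0 : 0 < a by rewrite divr_gt0.
(* The numerator stays below [L] unless the mean is large, and the standardised deviation stays
   above [a / Num.sqrt (2 * n%:R)] unless [X 0] and [X 1] are close; [K] is the quotient of these
   bounds. *)
pose K := L * Num.sqrt (2 * n%:R) / a.
have K0 : 0 < K by rewrite divr_gt0 // mulr_gt0 // sqrtr_gt0 mulr_gt0.
exists K => d T P X mu sigma k s0 iX tt Kk; have [_ lX] := iX.
have lX0 (B : set R) : measurable B ->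
  distribution P (X 0%N) B = normal_prob mu sigma B by move=> mB; exact: lX.
pose z i w := standardize mu sigma (X i w).
have mz i : measurable_fun setT (z i).
  by apply: measurableT_comp => //; exact: measurable_standardize.
have lin b : b ^+ 2 = M ^+ 2 ->
    (P [set w | (n%:R * M ^+ 2 <= b * \sum_(i < n) z i w)%R] <= (c / 4)%:E)%E.
  move=> be; have := @chernoff_gaussian R b 0 (M ^+ 2) (expR (b ^+ 2 / 2))
    mu sigma d T P X n _ iX.
  rewrite -expRD be (_ : M ^+ 2 / 2 + - M ^+ 2 = - (M ^+ 2 / 2)); last by field.
  rewrite (_ : mkset _ =
    mkset (fun w => n%:R * M ^+ 2 <= b * \sum_(i < n) z i w)); last first.
    apply/funext => w /=; congr (is_true (_ <= _)); rewrite mulr_sumr.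
    by apply: eq_bigr => i _; rewrite mul0r addr0.
  move=> H; apply: le_trans (H _) _; last first.
    rewrite lee_fin; have k0 := expR_ge0 (- (M ^+ 2 / 2)).
    have : expR (- (M ^+ 2 / 2)) <= c / 4.
      have -> : M ^+ 2 / 2 = 4 / c by rewrite M2; field; rewrite gt_eqF.
      rewrite expRN -[leRHS]invrK lef_pV2 ?posrE ?expR_gt0 ?invr_gt0 ?divr_gt0 //.
      rewrite invf_div; apply: le_trans (expR_ge1Dx _); lra.
    apply: le_trans; apply: (@le_trans _ _ (expR (- (M ^+ 2 / 2)) ^+ 1)) => //.
    apply: ler_wiXn2l => //.
    by rewrite -expR0 ler_expR oppr_le0 divr_ge0 // sqr_ge0.
  rewrite -be -(normal_mgf s0 lX0 b); apply: eq_integral => x _.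
  by rewrite mul0r addr0.
pose A1 := [set w | n%:R * M ^+ 2 <= M * \sum_(i < n) z i w].
pose A2 := [set w | n%:R * M ^+ 2 <= - M * \sum_(i < n) z i w].
pose A3 := [set w | `|X 0%N w - X 1%N w| <= sigma * a].
have mS : measurable_fun setT (fun w => \sum_(i < n) z i w).
  exact: measurable_sum.
have mA1 : measurable A1 by apply: measurable_superlevel; exact: measurable_funM.
have mA2 : measurable A2 by apply: measurable_superlevel; exact: measurable_funM.
have mA3 : measurable A3.
  rewrite (_ : A3 = [set w | - (sigma * a) <= - `|X 0%N w - X 1%N w|]).
    apply: measurable_superlevel; apply: measurableT_comp => //; apply: measurableT_comp => //.
    exact: measurable_funB.
  by apply/seteqP; split => w /=; rewrite lerN2.
have P1 : (P A1 <= (c / 4)%:E)%E by exact: lin.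
have P2 : (P A2 <= (c / 4)%:E)%E by apply: lin; rewrite sqrrN.
have P3 : (P A3 <= (c / 4)%:E)%E.
  apply: le_trans (gaussian_pair_close s0 (mulr_gt0 s0 a0) iX) _.
  (* This makes the probability of the band of half-width [sigma * a] at most [2 * a = c / 4],
     whatever [sigma] is. *)
  rewrite lee_fin; have : normal_peak sigma <= sigma^-1.
    rewrite /normal_peak lef_pV2 ?posrE //; last first.
      by rewrite sqrtr_gt0 pmulrn_lgt0 // mulr_gt0 ?pi_gt0 // exprn_gt0.
    rewrite -[leLHS]gtr0_norm // -sqrtr_sqr ler_sqrt; last first.
      by rewrite mulrn_wge0 // mulr_ge0 ?pi_ge0 // sqr_ge0.
    rewrite -mulrnAr ler_peMr ?sqr_ge0 // -mulr_natr.
    have := pi_ge2 R; lra.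
  rewrite -(ler_pM2r (mulr_gt0 s0 a0)) mulKf ?gt_eqF // /a; lra.
apply: (@le_trans _ _ (P ((A1 `|` A2) `|` A3))); last first.
  apply: le_trans (measureU2 _ _ _) _ => //; first exact: measurableU.
  apply: le_trans (leeD (measureU2 _ _ _) P3) _ => //.
  apply: le_trans (leeD (leeD P1 P2) (lexx _)) _.
  by rewrite -!EFinD lee_fin; lra.
apply: le_measure; rewrite ?inE.
- apply: measurable_superlevel; apply: measurable_funM => //.
  by apply: measurable_theta_hat => i.
- by apply: measurableU => //; exact: measurableU.
move=> w /= H; apply: contrapT => /not_orP[/not_orP[]].
rewrite /A1 /A2 /A3 /= => /negP + /negP + /negP.
rewrite -!ltNge => B1 B2 B3; move: H; apply/negP.
rewrite (theta_hat_standardize X mu w s0 n0) -ltNge.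
have := pair_deviation_le X mu sigma w n0 n2.
set zb := (\sum_(i < n) standardize mu sigma (X i w)) / n%:R.
set v := _ - zb ^+ 2 => Hv.
have z01 : a < `|standardize mu sigma (X 0%N w) - standardize mu sigma (X 1%N w)|.
  have -> : standardize mu sigma (X 0%N w) - standardize mu sigma (X 1%N w) =
            (X 0%N w - X 1%N w) / sigma.
    by rewrite /standardize; field; rewrite gt_eqF.
  by rewrite normrM normfV [ `|sigma| ]gtr0_norm // ltr_pdivlMr // mulrC.
have av : a ^+ 2 < 2 * n%:R * v.
  rewrite -mulrA; apply: lt_le_trans Hv.
  by rewrite -[ltRHS]real_normK ?num_real // ltr_pXn2r ?nnegrE // ltW.
have n20 : 0 < 2 * n%:R :> R by rewrite mulr_gt0.
have v0 : 0 < v by rewrite -(pmulr_rgt0 _ n20) (lt_trans _ av) // exprn_gt0.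
have at_ : a < Num.sqrt (2 * n%:R) * Num.sqrt v.
  rewrite -sqrtrM ?(ltW n20) // -[ltLHS]gtr0_norm // -sqrtr_sqr ltr_sqrt //.
  exact: mulr_gt0.
have t0 : 0 < Num.sqrt v by rewrite sqrtr_gt0.
have zbM : e * zb < M.
  apply: le_lt_trans (ler_norm _) _; rewrite normrM eN mul1r.
  rewrite /zb normrM normfV [ `|n%:R| ]gtr0_norm // ltr_pdivrMr // ltr_norml.
  move: B1 B2; rewrite /z; set S := \sum_(i < n) _ => B1 B2.
  by apply/andP; split; rewrite -(ltr_pM2l M0); nra.
rewrite mulrA ltr_pdivrMr // mulrDr.
apply: (@lt_le_trans _ _ L).
  rewrite /L; apply: ltr_leD => //; apply: le_trans tt _; exact: ler_norm.
apply: (@le_trans _ _ (K * Num.sqrt v)); last by rewrite ler_pM2r.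
rewrite /K mulrAC ler_pdivlMr // -mulrA ler_pM2l //; exact: ltW.
Qed.

End gaussian_tails.

(** * Summation of the errors over the stages *)

Lemma sum_increasing_le (R : numDomainType) (b : nat -> R) (N : nat -> nat)
    (s : nat) :
  (forall n, 0 <= b n) ->
  (forall l, (1 <= l < s)%N -> (N l < N l.+1)%N) ->
  \sum_(1 <= l < s.+1) b (N l) <= \sum_(0 <= k < (N s).+1) b k.
Proof.
move=> b0; elim: s => [|s IH] Ninc.
  by rewrite big_geq //; apply: sumr_ge0.
case: s => [|s] in IH Ninc *.
  by rewrite big_nat1 big_nat_recr //= lerDr; apply: sumr_ge0.
rewrite big_nat_recr //=.
have Ns : (N s.+1 < N s.+2)%N by apply: Ninc; rewrite /= ltnSn.
rewrite [leRHS]big_nat_recr //= lerD2r.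
apply: le_trans (IH _) _.
  by move=> l /andP[l1 ls]; apply: Ninc; rewrite l1 ltnW.
(* As [N s.+1 < N s.+2], the bound for the earlier stages is an initial segment of the sum left on
   the right. *)
rewrite [leRHS](@big_cat_nat _ _ _ (N s.+1).+1) //= lerDl.
by apply: sumr_ge0.
Qed.

(** [N0] and [K] come before the thresholds, the number of stages and the sample sizes, so the bound
    is uniform in plans whose form varies with zeta. *)
Lemma stagewise_error (R : realType) (th0 h e c : R) :
  0 < h -> e ^+ 2 = 1 -> 0 < c ->
  exists (N0 : nat) (K : R), forall (G : nat -> R),
  (forall n, (2 <= n)%N -> th0 + h <= G n) ->
  (forall n, (2 <= n < N0)%N -> K <= G n) ->
  forall d (T : measurableType d) (P : probability T R)
    (X : nat -> {RV P >-> R}) (mu sigma : R) (s : nat) (N : nat -> nat),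
  0 < sigma -> iid_gaussian X mu sigma -> e * (mu / sigma) <= th0 ->
  (2 <= N 1)%N -> (forall l, (1 <= l < s)%N -> (N l < N l.+1)%N) ->
  (\sum_(1 <= l < s.+1)
     P [set w | (G (N l) <= e * theta_hat X (N l) w)%R] <= c%:E)%E.
Proof.
move=> h0 e2 c0.
have [r /andP[r0 r1] Hr] := theta_hat_tail th0 h0 e2.
pose q := Num.sqrt r.
have q0 : 0 < q by rewrite sqrtr_gt0.
have qq : r = q ^+ 2 by rewrite sqr_sqrtr // ltW.
have q1 : q < 1 by rewrite -(@ltr_pXn2r _ 2) ?nnegrE ?ltW // expr1n -qq.
have q1' : 0 < 1 - q by rewrite subr_gt0.
(* The error budget c is split geometrically with ratio q = sqrt r, so that the
   exponential bound 4 r ^ n fits into its share for all n >= N0; the constant K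
   takes care of the remaining sample sizes. *)
pose b n := c * (1 - q) * q ^+ n.
have b0 n : 0 < b n by rewrite !mulr_gt0 // exprn_gt0.
have [N0 HN0] : exists N0, forall n, (N0 <= n)%N -> 4 * r ^+ n <= b n.
  have : q ^+ n @[n --> \oo] --> (0 : R) by apply: cvg_expr; rewrite gtr0_norm.
  move=> /cvgrPdist_lt /(_ (c * (1 - q) / 4)).
  rewrite divr_gt0 ?mulr_gt0 // => /(_ isT)[N0 _ HN]; exists N0 => n /HN /=.
  rewrite sub0r normrN gtr0_norm ?exprn_gt0 // => qn.
  rewrite qq -exprM mul2n -addnn exprD mulrA ler_wpM2r ?exprn_ge0 ?ltW //.
  by rewrite mulrC -ltr_pdivlMr.
have HK n : exists K : R, (2 <= n)%N ->
    forall d (T : measurableType d) (P : probability T R)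
      (X : nat -> {RV P >-> R}) (mu sigma k : R),
    0 < sigma -> iid_gaussian X mu sigma -> e * (mu / sigma) <= th0 -> K <= k ->
    (P [set w | (k <= e * theta_hat X n w)%R] <= (b n)%:E)%E.
  have [n2|n2] := leqP 2 n; last by exists 0.
  by have [K HK] := theta_hat_bounded_in_prob th0 e2 n2 (b0 n); exists K.
have [K {}HK] := choice HK.
(* The sum of absolute values dominates every [K n] with [n < N0]. *)
exists N0, (\sum_(0 <= n < N0) `|K n|) => G G1 G2 d T P X mu sigma s N s0 iX tt N1 Ninc.
have N2 l : (1 <= l <= s)%N -> (2 <= N l)%N.
  elim: l => // l IH /andP[_ ls]; case: l => // l in IH ls *.
  have NN : (N l.+1 < N l.+2)%N by exact: Ninc.
  by apply: ltnW; apply: leq_ltn_trans NN; apply: IH; exact: ltnW.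
apply: (@le_trans _ _ (\sum_(1 <= l < s.+1) (b (N l))%:E)%E).
  rewrite big_seq [leRHS]big_seq; apply: lee_sum => l.
  rewrite mem_index_iota ltnS => /N2 Nl.
  have [lN|lN] := leqP N0 (N l).
    apply: le_trans (_ : _ <= (4 * r ^+ N l)%:E)%E _; last by rewrite lee_fin HN0.
    apply: le_trans (Hr _ _ _ _ _ _ _ (ltnW Nl) s0 iX tt).
    have mth : measurable_fun setT (fun w => e * theta_hat X (N l) w).
      by apply: measurable_funM => //; apply: measurable_theta_hat => i.
    apply: le_measure; rewrite ?inE.
    - exact: measurable_superlevel.
    - exact: measurable_superlevel.
    by move=> w /=; apply: le_trans; exact: G1.
  apply: (HK (N l)) s0 iX tt _ => //; apply: (@le_trans _ _ `|K (N l)|).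
    exact: ler_norm.
  apply: le_trans (G2 _ _); last by rewrite Nl.
  rewrite (@big_cat_nat _ _ _ (N l)) ?(ltnW lN) //= [X in _ + X]big_ltn //.
  by rewrite addrCA lerDl; apply: addr_ge0; apply: sumr_ge0.
rewrite sumEFin lee_fin; apply: le_trans (sum_increasing_le _ Ninc) _.
  by move=> n; exact: ltW.
rewrite -mulr_sumr -mulrA.
have -> : (1 - q) * \sum_(0 <= i < (N s).+1) q ^+ i = 1 - q ^+ (N s).+1.
  by rewrite big_mkord -opprB mulNr -subrX1 opprB.
by rewrite ler_piMr ?(ltW c0) // gerBl exprn_ge0 // ltW.
Qed.

(** * Student tails and their link with percentiles *)

Section student_tail.
Context {R : realType}.
Local Notation mu := (@lebesgue_measure R).

Lemma student_kernelE (k : nat) (x : R) :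
  student_kernel k x = (Num.sqrt (1 + x ^+ 2 / k%:R))^-1 ^+ k.+1.
Proof.
have b0 : 0 <= 1 + x ^+ 2 / k%:R by rewrite addr_ge0 // divr_ge0 // sqr_ge0.
rewrite /student_kernel powRN exprVn; congr (_^-1).
by rewrite [_ / 2]mulrC powRrM powR12_sqrt // powR_mulrn // sqrtr_ge0.
Qed.

Lemma sqrt1D_ge1 (k : nat) (x : R) : 1 <= Num.sqrt (1 + x ^+ 2 / k%:R).
Proof.
rewrite -[leLHS]sqrtr1 ler_sqrt; first by rewrite lerDl divr_ge0 // sqr_ge0.
by rewrite addr_ge0 // divr_ge0 // sqr_ge0.
Qed.

Lemma student_kernel_gt0 (k : nat) (x : R) : 0 < student_kernel k x.
Proof.
by rewrite student_kernelE exprn_gt0 // invr_gt0 (lt_le_trans _ (sqrt1D_ge1 _ _)).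
Qed.

Lemma student_kernel_le (k : nat) (x y : R) : x ^+ 2 <= y ^+ 2 ->
  student_kernel k y <= student_kernel k x.
Proof.
move=> xy; rewrite !student_kernelE.
have g0 (z : R) : 0 < Num.sqrt (1 + z ^+ 2 / k%:R).
  exact: lt_le_trans ltr01 (sqrt1D_ge1 _ _).
rewrite lerXn2r ?nnegrE ?invr_ge0 ?(ltW (g0 _)) // lef_pV2 ?posrE //.
rewrite ler_sqrt; first by rewrite lerD2l ler_wpM2r // invr_ge0.
by rewrite addr_ge0 // divr_ge0 // sqr_ge0.
Qed.

Lemma continuous_student_kernel (k : nat) : continuous (@student_kernel R k).
Proof.
rewrite (_ : student_kernel k =
  fun x => (Num.sqrt (1 + x ^+ 2 / k%:R))^-1 ^+ k.+1); last first.
  by apply/funext => x; exact: student_kernelE.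
move=> x.
have cb : (1 + y ^+ 2 / k%:R : R) @[y --> x] --> 1 + x ^+ 2 / k%:R.
  apply: cvgD; first exact: cvg_cst.
  by apply: cvgM; [exact: exprn_continuous|exact: cvg_cst].
have cs : Num.sqrt (1 + y ^+ 2 / k%:R : R) @[y --> x] -->
          Num.sqrt (1 + x ^+ 2 / k%:R).
  by apply: (cvg_comp _ _ cb); exact: sqrt_continuous.
have ci : (Num.sqrt (1 + y ^+ 2 / k%:R : R))^-1 @[y --> x] -->
          (Num.sqrt (1 + x ^+ 2 / k%:R))^-1.
  by apply: cvgV cs; rewrite gt_eqF // (lt_le_trans _ (sqrt1D_ge1 _ _)).
apply: (@cvg_comp _ _ _ _ (fun y : R => y ^+ k.+1) _ _ _ ci).
exact: exprn_continuous.
Qed.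

Lemma measurable_student_kernel (k : nat) :
  measurable_fun setT (@student_kernel R k).
Proof. apply: continuous_measurable_fun; exact: continuous_student_kernel. Qed.

Lemma integral_oneDsqrV : (\int[mu]_x ((oneDsqr x)^-1)%:E = pi%:E)%E.
Proof.
rewrite ge0_symfun_integralT.
- by rewrite -set_itvcy integral0y_oneDsqr -EFinM; congr EFin; field.
- by move=> x; rewrite invr_ge0 (le_trans _ (oneDsqr_ge1 _)).
- exact: continuous_oneDsqrV.
- by move=> x /=; rewrite /oneDsqr sqrrN.
Qed.

(** Of the [k.+1] factors of the kernel, two give an integrable Cauchy kernel because
    [1 + x ^+ 2 / k >= (1 + x ^+ 2) / k]; the other [k.-1] are bounded by their value at [y] and
    carry the geometric decay. *)
Lemma student_kernel_oneDsqr (k : nat) (y x : R) : (0 < k)%N -> y ^+ 2 <= x ^+ 2 ->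
  student_kernel k x <=
  (Num.sqrt (1 + y ^+ 2 / k%:R))^-1 ^+ k.-1 * (k%:R * (oneDsqr x)^-1).
Proof.
case: k => // k _ yx; rewrite student_kernelE /= -[k.+2]addn2 exprD.
have g0 (z : R) : 0 < Num.sqrt (1 + z ^+ 2 / k.+1%:R).
  exact: lt_le_trans ltr01 (sqrt1D_ge1 _ _).
have p0 (z : R) : 0 <= 1 + z ^+ 2 / k.+1%:R.
  by rewrite addr_ge0 // divr_ge0 // sqr_ge0.
apply: ler_pM.
- by rewrite exprn_ge0 // invr_ge0 ltW.
- by rewrite sqr_ge0.
- rewrite lerXn2r ?nnegrE ?invr_ge0 ?(ltW (g0 _)) // lef_pV2 ?posrE //.
  by rewrite ler_sqrt // lerD2l ler_wpM2r // invr_ge0.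
rewrite exprVn sqr_sqrtr // /oneDsqr -[k.+1%:R * _]invrK invfM invrK.
have x1 : 0 < 1 + x ^+ 2 by rewrite ltr_pwDl // sqr_ge0.
have kR : 1 <= k.+1%:R :> R by rewrite ler1n.
rewrite lef_pV2 ?posrE.
- rewrite mulrDr mulr1 mulrC lerD2r invf_le1 //; exact: lt_le_trans kR.
- by rewrite ltr_pwDl // divr_ge0 // sqr_ge0.
- by rewrite mulr_gt0 // invr_gt0 (lt_le_trans _ kR).
Qed.

Lemma integral_student_kernel_lty (k : nat) : (0 < k)%N ->
  (\int[mu]_x (student_kernel k x)%:E < +oo)%E.
Proof.
move=> k0; apply: (@le_lt_trans _ _ (\int[mu]_x (k%:R * (oneDsqr x)^-1)%:E)%E).
  apply: ge0_le_integral => //.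
  - by move=> x _; rewrite lee_fin ltW // student_kernel_gt0.
  - apply/measurable_EFinP; exact: measurable_student_kernel.
  - apply/measurable_EFinP; apply: measurable_funM => //.
    apply: continuous_measurable_fun; exact: continuous_oneDsqrV.
  move=> x _; rewrite lee_fin.
  have := @student_kernel_oneDsqr k 0 x k0.
  rewrite expr0n /= mul0r addr0 sqrtr1 invr1 expr1n mul1r; apply.
  exact: sqr_ge0.
under eq_integral do rewrite EFinM.
rewrite ge0_integralZl //=.
- by rewrite integral_oneDsqrV -EFinM ltry.
- apply/measurable_EFinP; apply: continuous_measurable_fun; exact: continuous_oneDsqrV.
Qed.

Definition student_mass (k : nat) : R := \int[mu]_y student_kernel k y.

(** Left unnormalised: tails are compared at equal [k], where the factor [student_mass k]
    cancels. *)
Definition student_tail (k : nat) (t : R) : R :=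
  \int[mu]_(y in `]t, +oo[) student_kernel k y.

Lemma student_integral_fin (k : nat) (A : set R) : (0 < k)%N -> measurable A ->
  (\int[mu]_(x in A) (student_kernel k x)%:E =
   (\int[mu]_(x in A) student_kernel k x)%:E)%E.
Proof.
move=> k0 mA; rewrite /Rintegral fineK // ge0_fin_numE; last first.
  by apply: integral_ge0 => x _; rewrite lee_fin ltW // student_kernel_gt0.
apply: le_lt_trans (integral_student_kernel_lty k0).
apply: ge0_subset_integral => //.
- apply/measurable_EFinP; exact: measurable_student_kernel.
- by move=> x _; rewrite lee_fin ltW // student_kernel_gt0.
Qed.

(** The area of a rectangle lying under the decreasing kernel between [t] and [b]. *)
Lemma student_tail_lower (k : nat) (t b : R) : (0 < k)%N -> 0 <= t < b ->
  (b - t) * student_kernel k b <= student_tail k t.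
Proof.
move=> k0 /andP[t0 tb]; rewrite -lee_fin -student_integral_fin //.
apply: (@le_trans _ _ (\int[mu]_(x in `]t, b]) (student_kernel k b)%:E)%E).
  rewrite integral_cst //= lebesgue_measure_itv /= lte_fin tb.
  by rewrite -EFinB -EFinM mulrC.
apply: (@le_trans _ _ (\int[mu]_(x in `]t, b]) (student_kernel k x)%:E)%E).
  apply: ge0_le_integral => //.
  - by move=> x _; rewrite lee_fin ltW // student_kernel_gt0.
  - by apply/measurable_EFinP; apply: measurable_funTS; exact: measurable_student_kernel.
  move=> x; rewrite /= in_itv /= => /andP[tx xb]; rewrite lee_fin.
  by apply: student_kernel_le; rewrite ler_pXn2r ?nnegrE //; lra.
apply: ge0_subset_integral => //.
- by apply/measurable_EFinP; apply: measurable_funTS; exact: measurable_student_kernel.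
- by move=> x _; rewrite lee_fin ltW // student_kernel_gt0.
- by move=> x; rewrite /= !in_itv /= andbT => /andP[].
Qed.

Lemma student_tail_gt0 (k : nat) (t : R) : (0 < k)%N -> 0 <= t ->
  0 < student_tail k t.
Proof.
move=> k0 t0; apply: lt_le_trans (@student_tail_lower k t (t + 1) k0 _).
  by rewrite addrAC subrr add0r mul1r student_kernel_gt0.
by rewrite t0 ltrDl ltr01.
Qed.

Lemma student_tail_upper (k : nat) (t : R) : (0 < k)%N -> 0 <= t ->
  student_tail k t <=
  (Num.sqrt (1 + t ^+ 2 / k%:R))^-1 ^+ k.-1 * (k%:R * pi).
Proof.
move=> k0 t0; rewrite -lee_fin -student_integral_fin //.
set c := _ ^+ k.-1; have c0 : 0 <= c by rewrite exprn_ge0 // invr_ge0 sqrtr_ge0.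
have mo : measurable_fun setT (fun x : R => (oneDsqr x)^-1).
  apply: continuous_measurable_fun; exact: continuous_oneDsqrV.
have o0 x : 0 <= (oneDsqr x)^-1 :> R.
  by rewrite invr_ge0 (le_trans _ (oneDsqr_ge1 _)).
apply: (@le_trans _ _
  (\int[mu]_(x in `]t, +oo[) (c * (k%:R * (oneDsqr x)^-1))%:E)%E).
  apply: ge0_le_integral => //.
  - by move=> x _; rewrite lee_fin ltW // student_kernel_gt0.
  - by apply/measurable_EFinP; apply: measurable_funTS; exact: measurable_student_kernel.
  - apply/measurable_EFinP; apply: measurable_funTS; apply: measurable_funM => //.
    exact: measurable_funM.
  move=> x; rewrite /= in_itv /= andbT => tx; rewrite lee_fin.
  by apply: student_kernel_oneDsqr => //; rewrite ler_pXn2r ?nnegrE //; lra.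
apply: (@le_trans _ _ (\int[mu]_x (c * k%:R * (oneDsqr x)^-1)%:E)%E).
  under eq_integral do rewrite mulrA.
  apply: ge0_subset_integral => //.
  - by apply/measurable_EFinP; exact: measurable_funM.
  - by move=> x _; rewrite lee_fin mulr_ge0 // mulr_ge0.
under eq_integral do rewrite EFinM.
rewrite ge0_integralZl //=.
- by rewrite integral_oneDsqrV -EFinM mulrA.
- exact/measurable_EFinP.
- by rewrite lee_fin mulr_ge0.
Qed.

Lemma student_mass_split (k : nat) (t : R) : (0 < k)%N ->
  (\int[mu]_(x in `]-oo, t]) student_kernel k x) + student_tail k t =
  student_mass k.
Proof.
move=> k0; apply: EFin_inj; rewrite EFinD -!student_integral_fin //.
rewrite -ge0_integral_setU //=.
- by congr (integral _ _ _); rewrite -setCitvl setUv.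
- apply/measurable_EFinP; apply: measurable_funTS; exact: measurable_student_kernel.
- by move=> x _; rewrite lee_fin ltW // student_kernel_gt0.
- by rewrite -setCitvl; apply/disj_setPCl.
Qed.

Lemma student_tail0 (k : nat) : (0 < k)%N ->
  student_mass k = 2 * student_tail k 0.
Proof.
move=> k0; apply: EFin_inj; rewrite EFinM -!student_integral_fin //.
rewrite ge0_symfun_integralT.
- congr (_ * _)%E; rewrite -set_itvcy integral_itv_obnd_cbnd //.
  apply/measurable_EFinP; apply: measurable_funTS; exact: measurable_student_kernel.
- by move=> x; rewrite ltW // student_kernel_gt0.
- exact: continuous_student_kernel.
- by move=> x; rewrite /= /student_kernel sqrrN.
Qed.

Lemma student_mass_gt0 (k : nat) : (0 < k)%N -> 0 < student_mass k.
Proof. by move=> k0; rewrite student_tail0 // mulr_gt0 // student_tail_gt0. Qed.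

Lemma student_tail_anti (k : nat) (t u : R) : (0 < k)%N -> t <= u ->
  student_tail k u <= student_tail k t.
Proof.
move=> k0 tu; rewrite -lee_fin -!student_integral_fin //.
apply: ge0_subset_integral => //.
- by apply/measurable_EFinP; apply: measurable_funTS; exact: measurable_student_kernel.
- by move=> x _; rewrite lee_fin ltW // student_kernel_gt0.
- by move=> x; rewrite /= !in_itv /= !andbT; exact: le_lt_trans.
Qed.

Lemma student_probE (k : nat) (t : R) : (0 < k)%N ->
  student_prob k `]-oo, t] = (1 - student_tail k t / student_mass k)%:E.
Proof.
move=> k0; have I0 := student_mass_gt0 k0.
rewrite /student_prob /student_pdf -/(student_mass k).
under eq_integral do rewrite EFinM.
rewrite ge0_integralZr //=.
- rewrite student_integral_fin // -EFinM; congr EFin.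
  rewrite -(student_mass_split t k0) in I0 *.
  by field; rewrite gt_eqF.
- apply/measurable_EFinP; apply: measurable_funTS; exact: measurable_student_kernel.
- by move=> x _; rewrite lee_fin ltW // student_kernel_gt0.
- by rewrite lee_fin invr_ge0 ltW.
Qed.

Lemma student_tail_small (k : nat) (e : R) : (0 < k)%N -> 0 < e ->
  exists t, student_tail k t <= e.
Proof.
move=> k0 e0.
have cvgI : (\int[mu]_(x in `]-oo, i%:R]) (student_kernel k x)%:E @[i --> \oo]
    --> \int[mu]_x (student_kernel k x)%:E)%E.
  rewrite (_ : [set: R] = \bigcup_i `]-oo, i%:R]%classic); last first.
    apply/seteqP; split => // x _.
    have [N _ HN] := nbhs_infty_ger x; exists N => //=.
    by rewrite in_itv /=; apply: HN => /=.
  apply: ge0_nondecreasing_set_cvg_integral => //.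
  - move=> a b ab; apply/subsetPset => x /=; rewrite !in_itv /= => /le_trans.
    by apply; rewrite ler_nat.
  - move=> i; apply/measurable_EFinP; apply: measurable_funTS; exact: measurable_student_kernel.
  - by move=> i x _; rewrite lee_fin ltW // student_kernel_gt0.
have : (\int[mu]_(x in `]-oo, i%:R]) student_kernel k x) @[i --> \oo]
    --> student_mass k.
  apply: fine_cvg; rewrite -student_integral_fin //.
move=> /cvgrPdist_lt /(_ e e0)[N _ /(_ N (leqnn N))] /= H; exists N%:R.
move: H; rewrite -(student_mass_split N%:R k0) addrAC subrr add0r => H.
exact: le_trans (ler_norm _) (ltW H).
Qed.

(** Tails decrease, so every member of the set defining the percentile is at least [K]. The set must
    also be shown nonempty, since [inf] of the empty set is 0 by convention. *)
Lemma student_pct_ge (k : nat) (a K : R) : (0 < k)%N -> 0 < a ->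
  a * student_mass k < student_tail k K -> K <= student_pct k a.
Proof.
move=> k0 a0 aK; have I0 := student_mass_gt0 k0.
have [t Ht] := student_tail_small k0 (mulr_gt0 a0 I0).
apply: lb_le_inf.
  exists t; rewrite /= student_probE // lee_fin lerD2l lerN2.
  by rewrite ler_pdivrMr.
move=> u; rewrite /= student_probE // lee_fin lerD2l lerN2 ler_pdivrMr // => Hu.
rewrite leNgt; apply/negP => uK.
by move: aK; rewrite ltNge (le_trans (student_tail_anti k0 (ltW uK))).
Qed.

Lemma student_pct_ge0 (k : nat) (a : R) : (0 < k)%N -> 0 < a < 2^-1 ->
  0 <= student_pct k a.
Proof.
move=> k0 /andP[a0 a2]; apply: student_pct_ge => //.
rewrite student_tail0 //; have := @student_tail_gt0 k 0 k0 (lexx _); nra.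
Qed.

Lemma student_pct_le (k : nat) (a t : R) : (0 < k)%N -> 0 < a < 2^-1 ->
  student_tail k t <= a * student_mass k -> student_pct k a <= t.
Proof.
move=> k0 /andP[a0 a2] Ht; have I0 := student_mass_gt0 k0.
apply: ge_inf; last first.
  by rewrite /= student_probE // lee_fin lerD2l lerN2 ler_pdivrMr.
(* The set is bounded below by 0: left of 0 the tail is at least half the mass, while
   [a < 1 / 2]. *)
exists 0 => u; rewrite /= student_probE // lee_fin lerD2l lerN2 ler_pdivrMr // => Hu.
rewrite leNgt; apply/negP => u0.
have := student_tail_anti k0 (ltW u0).
have := @student_tail_gt0 k 0 k0 (lexx _); rewrite student_tail0 // in Hu; nra.
Qed.

End student_tail.

(** * Percentiles at small levels, uniformly in the degrees of freedom *)

Section student_percentiles.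
Context {R : realType}.

(** With [q = Num.sqrt r], one factor [q ^+ j] absorbs [j.+1], being the least term of a geometric
    sum bounded by [(1 - q)^-1]; the other factor tends to 0. *)
Lemma natrM_exp_small (r e : R) : 0 < r < 1 -> 0 < e ->
  exists J : nat, forall j, (J <= j)%N -> j.+1%:R * r ^+ j < e.
Proof.
move=> /andP[r0 r1] e0; pose q := Num.sqrt r.
have q0 : 0 < q by rewrite sqrtr_gt0.
have qq : r = q ^+ 2 by rewrite sqr_sqrtr // ltW.
have q1 : q < 1 by rewrite -(@ltr_pXn2r _ 2) ?nnegrE ?ltW // expr1n -qq.
have q1' : 0 < 1 - q by rewrite subr_gt0.
have geo j : j.+1%:R * q ^+ j * (1 - q) <= 1.
  apply: (@le_trans _ _ ((\sum_(i < j.+1) q ^+ i) * (1 - q))).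
    rewrite ler_pM2r // mulrC mulr_natr -[X in _ *+ X](card_ord j.+1) -sumr_const.
    by apply: ler_sum => i _; rewrite ler_wiXn2l ?ltW // -ltnS.
  by rewrite mulrC -opprB mulNr -subrX1 opprB gerBl exprn_ge0 // ltW.
have : q ^+ n @[n --> \oo] --> (0 : R) by apply: cvg_expr; rewrite gtr0_norm.
move=> /cvgrPdist_lt /(_ (e * (1 - q))).
rewrite mulr_gt0 // => /(_ isT)[J _ HJ]; exists J => j /HJ /=.
rewrite sub0r normrN gtr0_norm ?exprn_gt0 // => qj.
rewrite qq -exprM mul2n -addnn exprD -(ltr_pM2r q1').
apply: le_lt_trans qj; rewrite mulrA mulrAC.
by rewrite ler_piMl ?exprn_ge0 // ltW.
Qed.

(** A rectangle ending at the midpoint [c'] bounds the tail at [y] from below, and the Cauchy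
    comparison bounds the tail at [c] from above. Their quotient is of order [k * (w c / w c') ^ k],
    with [w c < w c']. *)
Lemma student_tail_ratio (y c K : R) : 0 <= y < c -> 0 < K ->
  exists J : nat, forall k, (0 < k)%N -> (J <= k)%N ->
  student_tail k (c * Num.sqrt k%:R) < K * student_tail k (y * Num.sqrt k%:R).
Proof.
move=> /andP[y0 yc] K0; pose c' := (y + c) / 2.
have yc' : y < c' by rewrite /c'; lra.
have c'c : c' < c by rewrite /c'; lra.
pose w (t : R) := (Num.sqrt (1 + t ^+ 2))^-1.
have w0 t : 0 < w t.
  by rewrite invr_gt0 sqrtr_gt0 ltr_pwDl // sqr_ge0.
have ww : w c < w c'.
  have p0 (t : R) : 0 < 1 + t ^+ 2 by rewrite ltr_pwDl // sqr_ge0.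
  rewrite ltf_pV2 ?posrE ?sqrtr_gt0 // ltr_sqrt // ltrD2l.
  by rewrite ltr_pXn2r ?nnegrE //; lra.
pose r := w c / w c'.
have r01 : 0 < r < 1 by rewrite divr_gt0 //= ltr_pdivrMr // mul1r.
pose C := K * (c' - y) * w c' ^+ 2.
have C0 : 0 < C by rewrite !mulr_gt0 ?exprn_gt0 // subr_gt0.
have [J HJ] := natrM_exp_small r01 (divr_gt0 C0 (pi_gt0 R)).
(* With [k = j.+1] the upper bound has exponent [j] and the lower one [j.+2]; the two surplus
   factors [w c'] are part of [C]. *)
exists J.+1 => -[//|j] _ Jj.
have sE (t : R) : (t * Num.sqrt j.+1%:R) ^+ 2 / j.+1%:R = t ^+ 2.
  by rewrite exprMn sqr_sqrtr // mulfK // pnatr_eq0.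
have s1 : 1 <= Num.sqrt j.+1%:R :> R.
  by rewrite -[leLHS]sqrtr1 ler_sqrt ?ler1n.
have s0 : 0 < Num.sqrt j.+1%:R :> R by exact: lt_le_trans ltr01 s1.
apply: (le_lt_trans (@student_tail_upper _ j.+1 _ isT _)).
  by rewrite mulr_ge0 ?(ltW s0) //; lra.
have := @student_tail_lower R j.+1 (y * Num.sqrt j.+1%:R) (c' * Num.sqrt j.+1%:R) isT.
rewrite mulr_ge0 ?(ltW s0) //= ltr_pM2r // yc' => /(_ isT) low.
apply: lt_le_trans (_ : _ < K * ((c' - y) * w c' ^+ j.+2)) _; last first.
  rewrite ler_pM2l //; apply: le_trans low.
  rewrite student_kernelE sE -/(w c') -mulrBl ler_pM2r ?exprn_gt0 //.
  by rewrite ler_peMr // subr_ge0 ltW.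
rewrite sE /= -/(w c).
have -> : w c = r * w c' by rewrite divfK // gt_eqF.
have -> : K * ((c' - y) * w c' ^+ j.+2) = C * w c' ^+ j.
  by rewrite /C -addn2 exprD; ring.
rewrite exprMn mulrAC ltr_pM2r ?exprn_gt0 //.
by rewrite mulrCA mulrA -ltr_pdivlMr ?pi_gt0 //; apply: HJ.
Qed.

Lemma small_uniform (Q : nat -> R -> Prop) (J : nat) :
  (forall k, exists2 a0, 0 < a0 & forall a, 0 < a < a0 -> Q k a) ->
  exists2 a0, 0 < a0 & forall k a, (k < J)%N -> 0 < a < a0 -> Q k a.
Proof.
move=> H; elim: J => [|J [a1 a10 H1]]; first by exists 1.
have [a2 a20 H2] := H J; exists (Num.min a1 a2); first by rewrite lt_min a10.
move=> k a; rewrite ltnS leq_eqVlt lt_min => /predU1P[->|kJ] /and3P[a0 aa1 aa2].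
  by apply: H2; rewrite a0.
by apply: H1; rewrite ?a0.
Qed.

Lemma student_pct_large (k : nat) (K : R) : (0 < k)%N ->
  exists2 a0, 0 < a0 & forall a, 0 < a < a0 -> K <= student_pct k a.
Proof.
move=> k0; pose t := Num.max 0 K.
have t0 : 0 <= t by rewrite le_max lexx.
exists (student_tail k t / student_mass k).
  by rewrite divr_gt0 ?student_mass_gt0 ?student_tail_gt0.
move=> a /andP[a0 at_]; apply: (@le_trans _ _ t); first by rewrite le_max lexx orbT.
by apply: student_pct_ge => //; rewrite -ltr_pdivlMr // student_mass_gt0.
Qed.

(** If the claim failed for some [k >= J], the percentiles would give [b * mass < tail (D / 2) < K *
    tail (D / 8) <= K * a * mass <= b * mass], with arguments scaled by [Num.sqrt k%:R]. The
    finitely many smaller [k] are settled by the percentile at [a] alone. *)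
Lemma student_pct_gap (D K : R) : 0 < D -> 0 < K ->
  exists2 a0, 0 < a0 & forall (k : nat) (a b : R), (0 < k)%N ->
  0 < a < a0 -> 0 < b < a0 -> K * a <= b ->
  D / 8 <= Num.max (student_pct k a / Num.sqrt k%:R)
    (D / 2 + (student_pct k a - student_pct k b) / (2 * Num.sqrt k%:R)).
Proof.
move=> D0 K0.
have yc : 0 <= D / 8 < D / 2 by apply/andP; split; lra.
have [J HJ] := student_tail_ratio yc K0.
pose Q k (a : R) := (0 < k)%N -> D / 8 * Num.sqrt k%:R <= student_pct k a.
have [a1 a10 H1] : exists2 a0, 0 < a0 &
    forall k a, (k < J)%N -> 0 < a < a0 -> Q k a.
  apply: small_uniform => -[|k]; first by exists 1 => // a _; rewrite /Q.
  have [a0 a00 H] := @student_pct_large k.+1 (D / 8 * Num.sqrt k.+1%:R) isT.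
  by exists a0 => // a /H Ha _.
exists (Num.min a1 2^-1); first by rewrite lt_min a10 /= invr_gt0 ltr0n.
move=> k a b k0; rewrite !lt_min => /and3P[a0 aa1 aa2] /and3P[b0 _ bb2] ab.
have I0 := @student_mass_gt0 R _ k0.
have s0 : 0 < Num.sqrt k%:R :> R by rewrite sqrtr_gt0 ltr0n.
rewrite leNgt gt_max; apply/negP => /andP[].
rewrite ltr_pdivrMr // => A1 B1.
have [kJ|Jk] := ltnP k J.
  have := H1 k a kJ; rewrite a0 aa1 => /(_ isT k0).
  by rewrite leNgt A1.
have A0 : 0 <= student_pct k a by apply: student_pct_ge0; rewrite ?a0.
(* In units of [Num.sqrt k%:R], the second entry being below [D / 8] forces the percentile at [b] to
   exceed that at [a] by more than [3 * D / 4], and the latter is nonnegative. *)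
have B2 : D / 2 * Num.sqrt k%:R < student_pct k b.
  move: B1; rewrite -(ltr_pM2r s0) mulrDl invfM !mulrA divfK ?gt_eqF //.
  move=> B1; nra.
have U1 : student_tail k (D / 8 * Num.sqrt k%:R) <= a * student_mass k.
  by rewrite leNgt; apply/negP => /(student_pct_ge k0 a0); rewrite leNgt A1.
have U2 : b * student_mass k < student_tail k (D / 2 * Num.sqrt k%:R).
  rewrite ltNge; apply/negP => H.
  have := @student_pct_le _ k b _ k0 _ H; rewrite b0 bb2 => /(_ isT).
  by rewrite leNgt B2.
have U3 := HJ k k0 Jk.
suff : b * student_mass k < b * student_mass k by rewrite ltxx.
apply: lt_le_trans U2 _; apply: le_trans (ltW U3) _.
apply: (@le_trans _ _ (K * (a * student_mass k))); first by rewrite ler_pM2l.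
by rewrite mulrA ler_pM2r.
Qed.

End student_percentiles.

(** * Asymptotics as the risk tuning parameter tends to 0 *)

Section risk_asymptotics.
Context {R : realType}.

Lemma near_forall_lt (Q : nat -> R -> Prop) (m : nat) :
  (forall i, (i < m)%N -> \forall z \near 0^'+, Q i z) ->
  \forall z \near 0^'+, forall i, (i < m)%N -> Q i z.
Proof.
elim: m => [|m IH] H; first by apply: nearW.
have H1 := IH (fun i im => H i (ltnW im)); have H2 := H m (ltnSn m).
near=> z => i; rewrite ltnS leq_eqVlt => /predU1P[->|im].
  by near: z.
by move: i im; near: z.
Unshelve. all: by end_near. Qed.

Lemma same_order_small (f : R -> R) (e : R) : same_order_at0 f -> 0 < e ->
  \forall z \near 0^'+, f z < e.
Proof.
move=> [A [B [A0 H]]] e0.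
pose B' := `|B| + 1.
have B'0 : 0 < B' by rewrite ltr_wpDl.
near=> z.
have z0 : 0 < z by near: z; exact: nbhs_right_gt.
have zB : z < e / B' by near: z; apply: nbhs_right_lt; rewrite divr_gt0.
have /andP[_] : A < f z / z < B by near: z.
rewrite ltr_pdivrMr // => fB; apply: lt_trans fB _.
move: zB; rewrite ltr_pdivlMr // mulrC; apply: le_lt_trans.
rewrite ler_pM2r //; apply: le_trans (ler_norm _) _.
by rewrite lerDl.
Unshelve. all: by end_near. Qed.

Lemma same_order_ratio (f g : R -> R) : same_order_at0 f -> same_order_at0 g ->
  exists2 K, 0 < K & \forall z \near 0^'+, K * f z <= g z.
Proof.
move=> [A [B [A0 H]]] [A' [B' [A'0 H']]].
pose C := `|B| + 1.
have C0 : 0 < C by rewrite ltr_wpDl.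
exists (A' / C); first by rewrite divr_gt0.
near=> z.
have z0 : 0 < z by near: z; exact: nbhs_right_gt.
have /andP[_] : A < f z / z < B by near: z.
have /andP[+ _] : A' < g z / z < B' by near: z.
rewrite ltr_pdivrMr // ltr_pdivlMr // => gz fz.
apply: le_trans (ltW gz).
rewrite mulrAC ler_pdivrMr // -mulrA ler_pM2l //.
apply: le_trans (ltW fz) _; rewrite mulrC ler_pM2l //.
by apply: le_trans (ler_norm _) _; rewrite lerDl.
Unshelve. all: by end_near. Qed.

(** Stated with a sign [e] and symmetric roles of [a] and [b], so that it serves crossings of
    [gbound] from below and, after negation and exchange of the two risks, crossings of [fbound]
    from above. The neighbourhood of 0 is fixed before the distribution and the plan. *)
Lemma threshold_error (th0 D e c : R) (a b : R -> R) :
  0 < D -> e ^+ 2 = 1 -> 0 < c ->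
  (\forall z \near 0^'+, 0 < a z < 1) -> (\forall z \near 0^'+, 0 < b z < 1) ->
  same_order_at0 a -> same_order_at0 b ->
  \forall z \near 0^'+, forall G : nat -> R,
  (forall n, (2 <= n)%N ->
     th0 + Num.max (student_pct n.-1 (a z) / Num.sqrt n.-1%:R)
       (D / 2 + (student_pct n.-1 (a z) - student_pct n.-1 (b z)) /
        (2 * Num.sqrt n.-1%:R)) <= G n) ->
  forall d (T : measurableType d) (P : probability T R)
    (X : nat -> {RV P >-> R}) (mu sigma : R) (s : nat) (N : nat -> nat),
  0 < sigma -> iid_gaussian X mu sigma -> e * (mu / sigma) <= th0 ->
  (2 <= N 1)%N -> (forall l, (1 <= l < s)%N -> (N l < N l.+1)%N) ->
  (\sum_(1 <= l < s.+1)
     P [set w | (G (N l) <= e * theta_hat X (N l) w)%R] <= c%:E)%E.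
Proof.
move=> D0 e2 c0 a01 b01 oa ob.
have D8 : 0 < D / 8 by rewrite divr_gt0.
have [N0 [K HE]] := stagewise_error th0 D8 e2 c0.
have [r r0 Hr] := same_order_ratio oa ob.
have [e1 e10 H1] := student_pct_gap D0 r0.
(* Rearranged, this says that [th0] plus the scaled percentile is at least [K], which
   [stagewise_error] asks for when [n < N0]. *)
pose Q n (x : R) := (2 <= n)%N ->
  (K - th0) * Num.sqrt n.-1%:R <= student_pct n.-1 x.
have [e3 e30 H2] : exists2 a0, 0 < a0 &
    forall n x, (n < N0)%N -> 0 < x < a0 -> Q n x.
  apply: small_uniform => -[|[|n]]; try by exists 1 => // x _; rewrite /Q.
  have [a0 a00 H] := @student_pct_large R n.+1 ((K - th0) * Num.sqrt n.+1%:R) isT.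
  by exists a0 => // x /H Hx _.
have sa1 := same_order_small oa e10; have sb1 := same_order_small ob e10.
have sa3 := same_order_small oa e30.
near=> z => G HG.
have /andP[az0 _] : 0 < a z < 1 by near: z.
have /andP[bz0 _] : 0 < b z < 1 by near: z.
have az1 : a z < e1 by near: z.
have bz1 : b z < e1 by near: z.
have az3 : a z < e3 by near: z.
have ab : r * a z <= b z by near: z.
have G1 n : (2 <= n)%N -> th0 + D / 8 <= G n.
  move=> n2; apply: le_trans (HG n n2); rewrite lerD2l.
  by apply: H1 => //; rewrite ?az0 ?bz0 //; case: n n2 => [|[|]].
have G2 n : (2 <= n < N0)%N -> K <= G n.
  move=> /andP[n2 nN]; apply: le_trans (HG n n2).
  rewrite -lerBlDl le_max; apply/orP; left.
  rewrite ler_pdivlMr; first by apply: (H2 n) => //; rewrite az0.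
  by rewrite sqrtr_gt0 ltr0n; case: n n2 nN => [|[|]].
exact: HE.
Unshelve. all: by end_near. Qed.

End risk_asymptotics.

(** * Thresholds and the decision rule *)

Section thresholds.
Context {R : realType}.
Variables (th' th'' a b : nat -> R) (n i : nat).

Lemma gboundE : gbound th' th'' a b n i =
  th' i + Num.max (student_pct n.-1 (a i) / Num.sqrt n.-1%:R)
   ((th'' i - th' i) / 2 + (student_pct n.-1 (a i) - student_pct n.-1 (b i)) /
      (2 * Num.sqrt n.-1%:R)).
Proof.
rewrite /gbound addr_maxr; congr (Num.max _ _).
by rewrite /midpoint addrA; congr (_ + _); field.
Qed.

(** Negation turns the minimum into a maximum and exchanges the two risks, so lower crossings take
    the form of upper ones. *)
Lemma fboundE : - fbound th' th'' a b n i =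
  - th'' i + Num.max (student_pct n.-1 (b i) / Num.sqrt n.-1%:R)
   ((th'' i - th' i) / 2 + (student_pct n.-1 (b i) - student_pct n.-1 (a i)) /
      (2 * Num.sqrt n.-1%:R)).
Proof.
rewrite /fbound oppr_min addr_maxr opprB [X in Num.max X]addrC.
congr (Num.max _ _); rewrite /midpoint opprD addrA; congr (_ + _).
  by field.
by rewrite -mulNr opprB.
Qed.

End thresholds.

Section decisions.
Context {R : realType}.
Variables (m : nat) (f g : nat -> R).

Lemma decision_gt (x : R) (j : nat) : (0 < j)%N ->
  decision m f g x = j.+1 -> g j < x.
Proof.
move=> j0; rewrite /decision; case: ifP => _; first by case: j j0.
case: pickP => [i /and3P[_ gi _] ij|_]; first by rewrite -[j]/(j.+1.-1) -ij.
by case: ifP => // gm mj; rewrite -[j]/(j.+1.-1) -mj.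
Qed.

Lemma decision_le (x : R) (j : nat) : (j.+1 < m)%N ->
  decision m f g x = j.+1 -> x <= f j.+1.
Proof.
move=> jm; rewrite /decision; case: ifP => [xf <- //|_].
case: pickP => [i /and3P[_ _ xf] <- //|_].
by case: ifP => // gm mj; rewrite mj ltnn in jm.
Qed.

(** A finite union over the truth tables satisfying [F]. It spares a branch-by-branch analysis of
    the [pick] in [decision]. *)
Lemma measurable_finite_test d (T : measurableType d) (I : finType)
    (p : I -> T -> bool) (F : {ffun I -> bool} -> Prop) :
  (forall i, measurable [set w | p i w]) ->
  measurable [set w | F [ffun i => p i w]].
Proof.
move=> mp; rewrite (_ : mkset _ = \bigcup_(v in [set v | F v])
    \bigcap_(i in [set: I]) [set w | p i w = v i]); last first.
  apply/seteqP; split => w /=.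
    by move=> Fw; exists [ffun i => p i w] => // i _ /=; rewrite ffunE.
  move=> [v Fv pv]; rewrite (_ : finfun _ = v) //.
  by apply/ffunP => i; rewrite ffunE; exact: pv.
apply: fin_bigcup_measurable => // v _; apply: fin_bigcap_measurable => // i _.
case: (v i); first exact: mp.
rewrite (_ : mkset _ = ~` [set w | p i w]); first exact: measurableC.
by apply/seteqP; split => w /=; [move=> ->|move/negP/negbTE].
Qed.

Lemma measurable_decision d (T : measurableType d) (Y : T -> R) (c : nat) :
  measurable_fun setT Y -> measurable [set w | decision m f g (Y w) = c].
Proof.
move=> mY.
have mle a : measurable [set w | Y w <= a].
  rewrite -[mkset _]setTI (_ : mkset _ = Y @^-1` `]-oo, a]); first exact: mY.
  by apply/seteqP; split => w /=; rewrite in_itv.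
have mgt a : measurable [set w | a < Y w].
  rewrite -[mkset _]setTI (_ : mkset _ = Y @^-1` `]a, +oo[); first exact: mY.
  by apply/seteqP; split => w /=; rewrite in_itv /= andbT.
pose p (t : 'I_m + bool) w := match t with
  | inl i => (2 <= i)%N && (g i.-1 < Y w <= f i)
  | inr true => Y w <= f 1%N
  | inr false => g m.-1 < Y w end.
pose F (v : {ffun 'I_m + bool -> bool}) :=
  (if v (inr true) then 1%N else if [pick i | v (inl i)] is Some i then i : nat
   else if v (inr false) then m else 0%N) = c.
have pickE w : [pick i | [ffun t => p t w] (inl i)] =
    [pick i : 'I_m | (2 <= i)%N && (g i.-1 < Y w <= f i)].
  by apply: eq_pick => i; rewrite ffunE.
rewrite (_ : mkset _ = [set w | F [ffun t => p t w]]); last first.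
  by apply/seteqP; split => w /=; rewrite /F /decision pickE !ffunE.
apply: measurable_finite_test => -[i|[|]] //=.
rewrite (_ : mkset _ = if (2 <= i)%N
    then [set w | g i.-1 < Y w] `&` [set w | Y w <= f i] else set0).
  by case: ifP => // _; exact: measurableI.
case: ifP => _; apply/seteqP; split => w //=; first by move/andP.
by move=> [? ?]; apply/andP.
Qed.

End decisions.

(** * The rejection event *)

Section rejection.
Context {d : measure_display} {T : measurableType d} {R : realType}.

Lemma Boole_inequality1 (P : probability T R) (A : nat -> set T) (s : nat) :
  (forall l, measurable (A l)) ->
  (P (\bigcup_(l in [set l | (1 <= l <= s)%N]) A l) <=
   \sum_(1 <= l < s.+1) P (A l))%E.
Proof.
move=> mA; rewrite big_add1 big_mkord /=.
rewrite (_ : bigcup _ _ = \big[setU/set0]_(l < s) A l.+1).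
  exact: (@Boole_inequality _ _ _ P (fun l => A l.+1)).
rewrite -(bigcup_mkord s (fun l => A l.+1)).
apply/seteqP; split => w [l /=].
  by case: l => // l ls Aw; exists l.
by move=> ls Aw; exists l.+1.
Qed.

Lemma measurable_reject (m s i : nat) (D : nat -> T -> nat) :
  (forall k c, measurable [set w | D k w = c]) ->
  measurable (reject m s D i).
Proof.
move=> mD; rewrite (_ : reject _ _ _ _ =
  \bigcup_(j in [set j | (j < m)%N /\ j <> i])
  \bigcup_(l in [set l | (1 <= l <= s)%N]) ([set w | D l w = j.+1] `&`
  \bigcap_(k in [set k | (1 <= k < l)%N]) [set w | D k w = 0%N])).
  apply: bigcup_measurable => j _; apply: bigcup_measurable => l _.
  apply: measurableI => //; exact: bigcap_measurableType.
apply/seteqP; split => w /=.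
  by move=> [j [jm ji [l [ls Dl Dk]]]]; exists j => //; exists l.
by move=> [j [jm ji] [l ls [Dl Dk]]]; exists j; split => //; exists l.
Qed.

End rejection.

(** The primed thresholds interlace, [th' k < th'' k <= th' k.+1], so the upper end [th' i.+1] of
    the zone bounds all later [th' k] from below. *)
Lemma varTheta_le (R : realType) (m : nat) (th' th'' : nat -> R) (i k : nat)
    (x : R) :
  (forall i, (1 <= i <= m.-1)%N -> th' i < th'' i) ->
  (forall i, (1 <= i <= m - 2)%N -> th'' i <= th' i.+1) ->
  (i < k <= m.-1)%N -> varTheta m th' th'' i x -> x <= th' k.
Proof.
move=> h1 h2 /andP[ik km] xi.
have : x <= th' i.+1.
  move: xi; rewrite /varTheta; case: eqP => [->|_]; first by rewrite /= in_itv.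
  rewrite ifF; first by rewrite /= in_itv /= => /andP[].
  by apply/negbTE; rewrite neq_ltn (leq_trans ik km).
elim: k ik km => // k IH; rewrite ltnS leq_eqVlt => /predU1P[<- //|ik] km xle.
have k0 : (0 < k)%N by exact: leq_ltn_trans ik.
apply: le_trans (IH ik (ltnW km) xle) _.
apply: (@le_trans _ _ (th'' k)); first by rewrite ltW // h1 // k0 ltnW.
by apply: h2; rewrite k0 /=; move: km; case: (m) => [|[|m']] //=; rewrite subSS subSS subn0.
Qed.

Lemma varTheta_ge (R : realType) (m : nat) (th' th'' : nat -> R) (i k : nat)
    (x : R) :
  (forall i, (1 <= i <= m.-1)%N -> th' i < th'' i) ->
  (forall i, (1 <= i <= m - 2)%N -> th'' i <= th' i.+1) ->
  (1 <= k <= i)%N -> (i < m)%N -> varTheta m th' th'' i x -> th'' k <= x.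
Proof.
move=> h1 h2 /andP[k0 ki] im xi.
have : th'' i <= x.
  move: xi; rewrite /varTheta ifF; last by apply/negbTE; rewrite -lt0n (leq_trans k0).
  by case: ifP => _; rewrite /= in_itv /= ?andbT // => /andP[].
apply: le_trans; elim: i ki im {xi} => [|i IH]; first by case: k k0.
rewrite leq_eqVlt => /predU1P[<- //|]; rewrite ltnS => ki im.
apply: le_trans (IH ki (ltnW im)) _.
have i0 : (0 < i)%N by exact: leq_trans ki.
apply: (@le_trans _ _ (th' i.+1)).
  by apply: h2; rewrite i0 /=; move: im; case: (m) => [|[|m']] //=; rewrite subSS subSS subn0 !ltnS.
by rewrite ltW // h1 //=; move: im; case: (m).
Qed.

Theorem theorem9 (R : realType) (m : nat) (hm : (2 <= m)%N)
  (th th' th'' : nat -> R)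
  (hth : forall i : nat, (1 <= i < m.-1)%N -> th i < th i.+1)
  (hth' : forall i : nat, (1 <= i <= m.-1)%N -> th' i < th i < th'' i)
  (hth'' : forall i : nat, (1 <= i <= m - 2)%N -> th'' i <= th' i.+1)
  (delta : nat -> R)
  (hdelta : forall i : nat, (i < m)%N -> 0 < delta i < 1)
  (alpha beta : nat -> R -> R)
  (halpha01 : forall i : nat, (1 <= i <= m.-1)%N ->
     \forall z \near 0^'+, 0 < alpha i z < 1)
  (halpha : forall i : nat, (1 <= i <= m.-1)%N -> same_order_at0 (alpha i))
  (hbeta01 : forall i : nat, (1 <= i <= m.-1)%N ->
     \forall z \near 0^'+, 0 < beta i z < 1)
  (hbeta : forall i : nat, (1 <= i <= m.-1)%N -> same_order_at0 (beta i))
  (s : R -> nat) (n : R -> nat -> nat)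
  (hs : \forall z \near 0^'+, (1 <= s z)%N)
  (hn1 : \forall z \near 0^'+, (2 <= n z 1)%N)
  (hn : \forall z \near 0^'+,
     forall l : nat, (1 <= l < s z)%N -> (n z l < n z l.+1)%N)
  (hns : \forall z \near 0^'+,
     exists N : nat,
       least_sufficient_size m th' th'' (alpha^~ z) (beta^~ z) N /\
       (N <= n z (s z))%N) :
  \forall z \near 0^'+,
    forall (i : nat), (i < m)%N ->
    forall (mu sigma : R), 0 < sigma ->
    varTheta m th' th'' i (mu / sigma) ->
    forall (d : measure_display) (T : measurableType d)
      (P : probability T R) (X : nat -> {RV P >-> R}),
    iid_gaussian X mu sigma ->
    let f (l : nat) := fbound th' th'' (alpha^~ z) (beta^~ z) (n z l) in
    let g (l : nat) := gbound th' th'' (alpha^~ z) (beta^~ z) (n z l) in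
    let D (l : nat) (w : T) := decision m (f l) (g l) (theta_hat X (n z l) w) in
    (P (reject m (s z) D i) <= (delta i)%:E)%E.
Proof.
have h1 k : (1 <= k <= m.-1)%N -> th' k < th'' k.
  by move=> /hth' /andP[]; exact: lt_trans.
have m0 : (0 < m)%N by exact: ltnW.
have mR : 0 < m%:R :> R by rewrite ltr0n.
(* Each of the [m.-1] thresholds receives the share [delta i / m] of the risk. *)
have c0 i : (i < m)%N -> 0 < delta i / m%:R.
  by move=> /hdelta /andP[di _]; rewrite divr_gt0.
have e1 : 1 ^+ 2 = 1 :> R by rewrite expr1n.
have eN1 : (- 1) ^+ 2 = 1 :> R by rewrite sqrrN.
(* For [e = 1] the reference value [th0] is [th' k], for [e = -1] it is [- th'' k]; the equation on
   [th0] lets one statement cover both. *)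
pose tail_le i e k (G : nat -> nat -> R) := forall d (T : measurableType d)
  (P : probability T R) (X : nat -> {RV P >-> R}) (mu sigma th0 : R) (s : nat)
  (N : nat -> nat), th0 = e * (if e == 1 then th' k else th'' k) ->
  0 < sigma -> iid_gaussian X mu sigma -> e * (mu / sigma) <= th0 ->
  (2 <= N 1)%N -> (forall l, (1 <= l < s)%N -> (N l < N l.+1)%N) ->
  (\sum_(1 <= l < s.+1) P [set w | (G (N l) k <= e * theta_hat X (N l) w)%R] <=
   (delta i / m%:R)%:E)%E.
have m1 k : (k.+1 < m)%N -> (1 <= k.+1 <= m.-1)%N by case: (m).
have eN : (- 1 == 1 :> R) = false by apply/negbTE; rewrite eq_sym -subr_eq0 opprK.
have upper : \forall z \near 0^'+, forall i, (i < m)%N -> forall k, (k < m)%N ->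
    (0 < k)%N -> tail_le i 1 k (gbound th' th'' (alpha^~ z) (beta^~ z)).
  apply: near_forall_lt => i im; apply: near_forall_lt => -[|k] km.
    by apply: nearW.
  have k1 := m1 k km; have D0 : 0 < th'' k.+1 - th' k.+1 by rewrite subr_gt0 h1.
  have := threshold_error (th' k.+1) D0 e1 (c0 i im) (halpha01 _ k1)
    (hbeta01 _ k1) (halpha _ k1) (hbeta _ k1).
  apply: filterS => z H _ d T P X mu sigma th0 s' N ->; rewrite eqxx [1 * th' _]mul1r.
  by apply: (H (fun n => gbound _ _ _ _ n k.+1)) => n' _; rewrite gboundE.
have lower : \forall z \near 0^'+, forall i, (i < m)%N -> forall k, (k < m)%N ->
    (0 < k)%N -> tail_le i (- 1) k
      (fun n k => - fbound th' th'' (alpha^~ z) (beta^~ z) n k).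
  apply: near_forall_lt => i im; apply: near_forall_lt => -[|k] km.
    by apply: nearW.
  have k1 := m1 k km; have D0 : 0 < th'' k.+1 - th' k.+1 by rewrite subr_gt0 h1.
  have := threshold_error (- th'' k.+1) D0 eN1 (c0 i im) (hbeta01 _ k1)
    (halpha01 _ k1) (hbeta _ k1) (halpha _ k1).
  apply: filterS => z H _ d T P X mu sigma th0 s' N ->; rewrite eN [_ * th'' _]mulN1r.
  by apply: (H (fun n => - fbound _ _ _ _ n k.+1)) => n' _; rewrite fboundE.
near=> z => i im mu sigma s0 vt d T P X iX.
pose f (l : nat) := fbound th' th'' (alpha^~ z) (beta^~ z) (n z l).
pose g (l : nat) := gbound th' th'' (alpha^~ z) (beta^~ z) (n z l).
pose D (l : nat) (w : T) := decision m (f l) (g l) (theta_hat X (n z l) w).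
change (P (reject m (s z) D i) <= (delta i)%:E)%E.
have n1 : (2 <= n z 1)%N by near: z.
have nS : forall l : nat, (1 <= l < s z)%N -> (n z l < n z l.+1)%N by near: z.
have U : forall i, (i < m)%N -> forall k, (k < m)%N ->
    (0 < k)%N -> tail_le i 1 k (gbound th' th'' (alpha^~ z) (beta^~ z)).
  by near: z.
have L : forall i, (i < m)%N -> forall k, (k < m)%N ->
    (0 < k)%N -> tail_le i (- 1) k
      (fun n k => - fbound th' th'' (alpha^~ z) (beta^~ z) n k).
  by near: z.
pose Y l := theta_hat X (n z l).
have mY l : measurable_fun setT (Y l) by apply: measurable_theta_hat => j.
(* Above the true index [i] the error is to exceed [g], at or below it to fall under [f]; strictness
   is dropped so that both are superlevel sets. *)
pose B k l := if (i < k)%N then [set w | g l k <= 1 * Y l w]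
              else [set w | - f l k <= - 1 * Y l w].
have mB k l : measurable (B k l).
  by rewrite /B; case: ifP => _; apply: measurable_superlevel; exact: measurable_funM.
have mBU k : measurable (\bigcup_(l in [set l | (1 <= l <= s z)%N]) B k l).
  by apply: bigcup_measurable => l _; exact: mB.
apply: (@le_trans _ _ (P (\bigcup_(k in [set k | (1 <= k <= m.-1)%N])
    \bigcup_(l in [set l | (1 <= l <= s z)%N]) B k l))).
  apply: le_measure; rewrite ?inE.
  - by apply: measurable_reject => k c; apply: measurable_decision; exact: mY.
  - by apply: bigcup_measurable => k _; exact: mBU.
  move=> w [j [jm ji [l [ls Dl _]]]].
  (* Accepting some [j > i] crosses the threshold [j] upwards; accepting some [j < i] crosses the
     threshold [j.+1 <= i] downwards. *)
  have [ij|ij|ij] := ltngtP i j; last by rewrite ij in ji.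
    have j0 : (0 < j)%N by exact: leq_ltn_trans ij.
    have jm1 : (1 <= j <= m.-1)%N by rewrite j0 -ltnS prednK.
    exists j; first exact: jm1.
    exists l => //; rewrite /B ij /= mul1r; apply: ltW.
    exact: decision_gt Dl.
  have jm' : (j.+1 < m)%N by exact: leq_ltn_trans im.
  exists j.+1; first exact: m1.
  exists l => //; rewrite /B ltnNge ij /= mulN1r lerN2.
  exact: decision_le Dl.
apply: le_trans (Boole_inequality1 _ _ mBU) _.
apply: (@le_trans _ _ (\sum_(1 <= k < m.-1.+1) (delta i / m%:R)%:E)%E).
  rewrite big_seq [leRHS]big_seq; apply: lee_sum => k.
  rewrite mem_index_iota => /andP[k0 km].
  have km' : (k < m)%N by rewrite prednK in km.
  apply: le_trans (Boole_inequality1 _ _ (mB k)) _.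
  rewrite /B; case: ltnP => ik.
    apply: (U i im k km' k0 d T P X mu sigma) => //.
    rewrite eqxx !mul1r; apply: varTheta_le vt => //; rewrite ik -ltnS.
    exact: km.
  apply: (L i im k km' k0 d T P X mu sigma) => //.
  rewrite eN !mulN1r lerN2; apply: varTheta_ge vt => //.
  by rewrite k0.
rewrite sumEFin lee_fin sumr_const_nat subn1 /= -[_ *+ m.-1]mulr_natr -mulrA mulrC.
rewrite ler_piMl //; first by case/andP: (hdelta i im) => /ltW.
by rewrite mulrC ler_pdivrMr // mul1r ler_nat leq_pred.
Unshelve. all: by end_near. Qed.
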